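(* There is a constant $\xi>0$, not depending on the graph, such that the following holds. Let $G$ be a connected graph that contains no cycle of length $4$ and no cycle of length $6$ as a subgraph, with $n$ vertices, $m$ edges and degree sequence $d_1\ge d_2\ge\cdots\ge d_n\ge 2$. Then $G$ admits a bisection of size at least \[\frac{m}{2}+\xi\sum_{i=1}^{n}\sqrt{d_i}.\]
   Context: A bisection of a graph $G$ is a partition $(V_0,V_1)$ of $V(G)$ into two disjoint sets with $\big||V_0|-|V_1|\big|\le 1$; its size is the number of edges of $G$ with one endpoint in $V_0$ and the other in $V_1$. *)

(* Defs.v *)
From HB Require Import structures.
From mathcomp Require Import all_boot all_order all_algebra.
From mathcomp Require Import reals.
Set Implicit Arguments.
Unset Strict Implicit.
Unset Printing Implicit Defensive.
Import Order.TTheory GRing.Theory Num.Theory.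

Record sgraph := SGraph {
  vertex :> finType;
  adj : rel vertex;
  adj_sym : symmetric adj;
  adj_irrefl : irreflexive adj }.

Definition edges (G : sgraph) : {set {set G}} :=
  [set [set x; y] | x in G, y in G & adj x y].

Definition degree (G : sgraph) (x : G) : nat := #|[set y : G | adj x y]|.

Definition degree_sequence (G : sgraph) : seq nat :=
  sort geq [seq degree x | x : G].

Definition connected_graph (G : sgraph) : Prop :=
  0 < #|G| /\ forall x y : G, connect (@adj G) x y.

(* Not necessarily induced; a cycle is listed by its k distinct vertices in
   cyclic order, so this is only meaningful for k >= 3 (for k = 2 it would
   accept a single edge). *)
Definition has_cycle (G : sgraph) (k : nat) : Prop :=
  exists2 c : seq G, ucycle (@adj G) c & size c = k.

Definition is_bisection (G : sgraph) (V0 V1 : {set G}) : Prop :=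
  [/\ V0 :|: V1 = [set: G], [disjoint V0 & V1]
    & (`| #|V0|%:Z - #|V1|%:Z | <= 1 :> int)%R].

Definition bisection_size (G : sgraph) (V0 V1 : {set G}) : nat :=
  #|[set E in edges G | [exists x in V0, exists y in V1, E == [set x; y]]]|.

(* Main.v *)
Require Import Defs.
From HB Require Import structures.
From mathcomp Require Import all_boot all_order all_algebra all_fingroup.
From mathcomp Require Import reals.
From mathcomp Require Import ring lra zify.
Set Implicit Arguments.
Unset Strict Implicit.
Unset Printing Implicit Defensive.
Import Order.TTheory GRing.Theory Num.Theory.
Local Open Scope ring_scope.

(** Add an isolated vertex if necessary to make the number [n] of vertices even,
    fix a pairing [s] of the vertices, and only consider partitions separating
    every pair.  Such partitions are given by a sign per pair, and the size of the
    cut is at least [m / 2] minus a quarter of a quadratic form in these signs,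
    whose coefficient at two pairs is a signed count of the edges between them.

    The form is made very negative in one step of local improvement: signs on a
    set [A] of pairs are random, and each remaining pair takes (in the mean) a
    small multiple of minus the clipped field it feels.  This gains a constant
    times the square root of the degree of each pair, up to a second-order loss
    carried by the triangles of the multigraph of pairs.

    For a uniformly random pairing, the absence of 4-cycles gives
    [sum_x d(x)^2 <= 2 n^2], whence the expected loss is [O(n)], and few edges at a
    pair cancel: two vertices have at most one common neighbour and degree at
    least two, and on average few pairs lie in one neighbourhood.  Bounded [n] is
    settled by putting a single edge into the pairing. *)

(** * Rademacher averages *)

Section Rademacher.
Variable R : rcfType.
Implicit Types (x y t : R) (l : seq (R * R)) (H : R -> R -> R).

(* The mean of [H (x + sum_i e_i u_i) (y + sum_i e_i v_i)] over independent
   uniform signs [e_i], where [l] lists the pairs [(u_i, v_i)]. *)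
Fixpoint rad l H x y : R :=
  if l is (u, v) :: l' then
    (rad l' H (x + u) (y + v) + rad l' H (x - u) (y - v)) / 2
  else H x y.

Lemma rad_le l H K x y :
  (forall x y, H x y <= K x y) -> rad l H x y <= rad l K x y.
Proof.
move=> HK; elim: l x y => [|[u v] l IH] x y /=; first exact: HK.
by have := IH (x + u) (y + v); have := IH (x - u) (y - v); lra.
Qed.

Lemma rad_lin l a b H K x y :
  rad l (fun x y => a * H x y + b * K x y) x y = a * rad l H x y + b * rad l K x y.
Proof. by elim: l x y => [|[u v] l IH] x y //=; rewrite !IH; field. Qed.

Lemma rad_mul l x y :
  rad l (fun x y => x * y) x y = x * y + \sum_(c <- l) c.1 * c.2.
Proof.
elim: l x y => [|[u v] l IH] x y /=; first by rewrite big_nil addr0.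
by rewrite !IH big_cons /=; field.
Qed.

Lemma rad_pow2 l x y :
  rad l (fun x _ => x ^+ 2) x y = x ^+ 2 + \sum_(c <- l) c.1 ^+ 2.
Proof.
elim: l x y => [|[u v] l IH] x y /=; first by rewrite big_nil addr0.
by rewrite !IH big_cons /=; field.
Qed.

(** Khintchine's fourth moment bound. Averaging the induction hypothesis over one more sign of
    influence [u] leaves a slack of exactly [2 * u ^+ 4], so the constants 6 and 3 reproduce
    themselves. *)
Lemma rad_pow4 l x y :
  rad l (fun x _ => x ^+ 4) x y <=
    x ^+ 4 + 6 * x ^+ 2 * (\sum_(c <- l) c.1 ^+ 2) +
    3 * (\sum_(c <- l) c.1 ^+ 2) ^+ 2.
Proof.
elim: l x y => [|[u v] l IH] x y /=; first by rewrite big_nil; lra.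
rewrite big_cons /=; set s := \sum_(c <- l) _ in IH *.
have h1 := IH (x + u) (y + v); have h2 := IH (x - u) (y - v).
have hu : 0 <= u ^+ 4 by rewrite (_ : 4 = 2 * 2)%N // exprM sqr_ge0.
lra.
Qed.

Lemma rad_odd l H x y : (forall x y, H (- x) (- y) = - H x y) ->
  rad l H (- x) (- y) = - rad l H x y.
Proof.
move=> Hodd; elim: l x y => [|[u v] l IH] x y /=; first exact: Hodd.
have -> : - x + u = - (x - u) by ring.
have -> : - y + v = - (y - v) by ring.
by rewrite -!opprD !IH; field.
Qed.

Lemma rad_lipl l (f : R -> R) s x y x' y' :
  (forall x x', `|f x - f x'| <= s * `|x - x'|) ->
  `|rad l (fun x _ => f x) x y - rad l (fun x _ => f x) x' y'| <= s * `|x - x'|.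
Proof.
move=> hf; elim: l x y x' y' => [|[u v] l IH] x y x' y' //=.
have := IH (x + u) (y + v) (x' + u) (y' + v).
have := IH (x - u) (y - v) (x' - u) (y' - v).
have -> : x - u - (x' - u) = x - x' by ring.
have -> : x + u - (x' + u) = x - x' by ring.
by rewrite !ler_norml => /andP[? ?] /andP[? ?]; apply/andP; split; lra.
Qed.

Lemma rad_lipr l (g : R -> R) s x y x' y' :
  (forall y y', `|g y - g y'| <= s * `|y - y'|) ->
  `|rad l (fun _ y => g y) x y - rad l (fun _ y => g y) x' y'| <= s * `|y - y'|.
Proof.
move=> hg; elim: l x y x' y' => [|[u v] l IH] x y x' y' //=.
have := IH (x + u) (y + v) (x' + u) (y' + v).
have := IH (x - u) (y - v) (x' - u) (y' - v).
have -> : y - v - (y' - v) = y - y' by ring.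
have -> : y + v - (y' + v) = y - y' by ring.
by rewrite !ler_norml => /andP[? ?] /andP[? ?]; apply/andP; split; lra.
Qed.

(* Each sign contributes a covariance of at most the product of the two
   influences it has. *)
Lemma rad_cov l (f g : R -> R) s t x y : 0 <= s -> 0 <= t ->
  (forall x x', `|f x - f x'| <= s * `|x - x'|) ->
  (forall y y', `|g y - g y'| <= t * `|y - y'|) ->
  `|rad l (fun x y => f x * g y) x y -
    rad l (fun x _ => f x) x y * rad l (fun _ y => g y) x y| <=
  s * t * \sum_(c <- l) `|c.1| * `|c.2|.
Proof.
move=> s0 t0 hf hg; elim: l x y => [|[u v] l IH] x y /=.
  by rewrite subrr normr0 big_nil mulr0.
rewrite big_cons /=; have := IH (x + u) (y + v); have := IH (x - u) (y - v).
have := rad_lipl l (x + u) (y + v) (x - u) (y - v) hf.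
have := rad_lipr l (x + u) (y + v) (x - u) (y - v) hg.
set a1 := rad l (fun x _ => f x) _ _; set a2 := rad l (fun x _ => f x) _ _.
set b1 := rad l (fun _ y => g y) _ _; set b2 := rad l (fun _ y => g y) _ _.
set c2 := rad l _ _ _; set c1 := rad l _ _ _.
set S := \sum_(c <- l) _.
have -> : y + v - (y - v) = 2 * v by ring.
have -> : x + u - (x - u) = 2 * u by ring.
rewrite !normrM (ger0_norm (_ : 0 <= 2 :> R)) // => hb ha h1 h2.
have hab : `|(a1 - a2) * (b1 - b2)| <= (s * (2 * `|u|)) * (t * (2 * `|v|)).
  by rewrite normrM; apply: ler_pM.
(* Law of total covariance for the first sign: the mean of the conditional covariances plus the
   covariance of the conditional means. *)
have -> : (c1 + c2) / 2 - (a1 + a2) / 2 * ((b1 + b2) / 2) =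
  ((c1 - a1 * b1) + (c2 - a2 * b2)) / 2 + (a1 - a2) * (b1 - b2) / 4 by field.
move: h1 h2 hab; rewrite !ler_norml => /andP[? ?] /andP[? ?] /andP[? ?].
by apply/andP; split; lra.
Qed.

(** Truncation keeps a real assignment in the range that can be rounded to signs; being odd and
    1-Lipschitz, it preserves mean zero and small covariances. *)
Definition clip x : R := Num.max (-1) (Num.min 1 x).

Lemma clipN x : clip (- x) = - clip x.
Proof. by rewrite /clip !minEle !maxEle; do !case: ifP => /=; lra. Qed.

Lemma clip_lip x y : `|clip x - clip y| <= `|x - y|.
Proof.
rewrite /clip !minEle !maxEle.
case: (leP 0 (x - y)) => h; [rewrite (ger0_norm h)|rewrite (ltr0_norm h)];
  rewrite ler_norml; apply/andP; split; do !case: ifP => /=; lra.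
Qed.

Lemma clip_bound x : -1 <= clip x <= 1.
Proof. by rewrite /clip !minEle !maxEle; apply/andP; split; do !case: ifP => /=; lra. Qed.

(** Trades truncation for a fourth moment: clipping is the identity up to absolute value 1, and
    beyond it the left-hand side is at most 0. *)
Lemma mul_clip_ge x : x ^+ 2 - x ^+ 4 <= x * clip x.
Proof.
have h : 1 < `|x| -> x ^+ 2 - x ^+ 4 <= 0.
  move=> hx; have -> : x ^+ 2 - x ^+ 4 = x ^+ 2 * (1 - x ^+ 2) by ring.
  rewrite mulr_ge0_le0 ?sqr_ge0 // subr_le0 -real_normK ?num_real //.
  by rewrite exprn_ege1 // ltW.
have h4 : 0 <= x ^+ 4 by rewrite (_ : 4 = 2 * 2)%N // exprM sqr_ge0.
have [hx|hx] := ltP 1 `|x|.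
  have := h hx; move: hx; rewrite /clip lter_normr minEle maxEle => /orP[hx|hx].
    by do !case: ifP => /=; lra.
  by do !case: ifP => /=; lra.
suff -> : clip x = x by rewrite -expr2; lra.
move: hx; rewrite ler_norml /clip minEle maxEle => /andP[? ?].
by do !case: ifP => /=; lra.
Qed.

End Rademacher.

(** * Signs making a quadratic form negative *)

Section SignedQuadraticForm.
Variables (R : rcfType) (P : finType).
Implicit Types (z : P -> R) (F : (P -> R) -> R) (l : seq P).

Definition upd z p x : P -> R := fun q => if q == p then x else z q.

(* The mean of [F] when the values of [z] at the points of [l] are replaced by
   independent uniform signs. *)
Fixpoint avg l F z : R :=
  if l is p :: l' then (avg l' F (upd z p 1) + avg l' F (upd z p (-1))) / 2
  else F z.

Lemma avg_exists l F z : exists e : P -> R,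
  [/\ forall p, p \in l -> e p = 1 \/ e p = -1,
      forall p, p \notin l -> e p = z p & F e <= avg l F z].
Proof.
elim: l z => [|p l IH] z /=; first by exists z.
have [x [hx lex]] : exists x : R, (x = 1 \/ x = -1) /\ avg l F (upd z p x) <=
    (avg l F (upd z p 1) + avg l F (upd z p (-1))) / 2.
  case: (leP (avg l F (upd z p 1)) (avg l F (upd z p (-1)))) => h.
    by exists 1; split; [left|lra].
  by exists (-1); split; [right|lra].
have [e [he1 he2 he3]] := IH (upd z p x); exists e; split; last exact: le_trans lex.
- move=> q; rewrite inE; case: (boolP (q \in l)) => [/he1 //|/he2 ->].
  by rewrite orbF /upd => ->.
- by move=> q; rewrite inE negb_or => /andP[/negbTE qp /he2 ->]; rewrite /upd qp.
Qed.

Lemma avg_sum (I : Type) (r : seq I) (Q : pred I) (F : I -> (P -> R) -> R) l z :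
  avg l (fun z => \sum_(i <- r | Q i) F i z) z = \sum_(i <- r | Q i) avg l (F i) z.
Proof.
by elim: l z => [|p l IH] z //=; rewrite !IH -big_split mulr_suml.
Qed.

Lemma avg_ext l F F' z : (forall z, F z = F' z) -> avg l F z = avg l F' z.
Proof. by move=> h; elim: l z => [|p l IH] z //=; rewrite !IH. Qed.

Lemma avg_add l F F' z : avg l (fun z => F z + F' z) z = avg l F z + avg l F' z.
Proof. by elim: l z => [|p l IH] z //=; rewrite !IH; field. Qed.

Lemma avg_scale l a F z : avg l (fun z => a * F z) z = a * avg l F z.
Proof. by elim: l z => [|p l IH] z //=; rewrite !IH; field. Qed.

(** A function of two linear forms sees each sign only through its pair of coefficients. The values
    of [z] on [l] must be 0 because [upd] overwrites them whereas [rad] adds to the starting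
    point. *)
Lemma avg_rad (H : R -> R -> R) (u v : P -> R) l z :
  uniq l -> (forall p, p \in l -> z p = 0) ->
  avg l (fun z => H (\sum_p u p * z p) (\sum_p v p * z p)) z =
  rad [seq (u p, v p) | p <- l] H (\sum_p u p * z p) (\sum_p v p * z p).
Proof.
have updE (t : P -> R) (y : P -> R) p x : y p = 0 ->
    \sum_q t q * upd y p x q = \sum_q t q * y q + t p * x.
  move=> yp; rewrite (bigD1 p) //= [in RHS](bigD1 p) //= yp /upd eqxx.
  under eq_bigr => q /negbTE -> do [].
  by rewrite mulr0 add0r addrC.
elim: l z => [|p l IH] z //= /andP[pl ul] hz.
rewrite !IH ?updE ?mulr1 ?mulrN1 //; try by rewrite hz ?inE ?eqxx.
all: move=> q ql; rewrite /upd; case: eqP => [qp|_]; first by rewrite -qp ql in pl.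
all: by rewrite hz // inE ql orbT.
Qed.

(** The shifts let one rounding argument serve twice: [0, 0] gives the quadratic form itself,
    [1, -1] a directed cut. *)
Definition bilin (c : P -> P -> R) (a b : R) z : R :=
  \sum_p \sum_q c p q * (a + z p) * (b + z q).

(* Without diagonal terms the form is affine in each coordinate. *)
Lemma bilin_round c a b z : (forall p, c p p = 0) ->
  (forall p, -1 <= z p <= 1) ->
  exists2 e : P -> R, (forall p, e p = 1 \/ e p = -1) & bilin c a b e <= bilin c a b z.
Proof.
move=> c0.
have aff y r : bilin c a b y = (1 + y r) / 2 * bilin c a b (upd y r 1) +
    (1 - y r) / 2 * bilin c a b (upd y r (-1)).
  rewrite /bilin !mulr_sumr -big_split; apply: eq_bigr => p _ /=.
  rewrite !mulr_sumr -big_split; apply: eq_bigr => q _ /=.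
  by rewrite /upd; case: (p =P r) => [->|_]; case: (q =P r) => [->|_]; rewrite ?c0; field.
suff main l : forall y : P -> R, (forall p, -1 <= y p <= 1) -> exists e : P -> R,
   [/\ forall p, p \in l -> e p = 1 \/ e p = -1, forall p, -1 <= e p <= 1
     & bilin c a b e <= bilin c a b y].
  move=> hz; have [e [he _ ?]] := main (enum P) z hz.
  by exists e => // p; apply: he; rewrite mem_enum.
elim: l => [|p l IH] y hy; first by exists y.
have hupd x : x = 1 \/ x = -1 -> forall q, -1 <= upd y p x q <= 1.
  by move=> hx q; rewrite /upd; case: eqP => // _; case: hx => ->; lra.
have [e [he1 he2 he3]] := IH y hy.
have [x hx lex] : exists2 x : R, x = 1 \/ x = -1 &
    bilin c a b (upd e p x) <= bilin c a b e.
  have eqe := aff e p; have /andP[? ?] := he2 p.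
  case: (leP (bilin c a b (upd e p 1)) (bilin c a b (upd e p (-1)))) => h.
    by exists 1; [left|rewrite eqe; nra].
  by exists (-1); [right|rewrite eqe; nra].
exists (upd e p x); split; last exact: le_trans he3.
- move=> q; rewrite inE /upd; case: eqP => //= _; exact: he1.
- by move=> q; rewrite /upd; case: eqP => // _; case: hx => ->; lra.
Qed.

(** * Random signs on one side of a directed cut *)

Variables (w : P -> P -> R) (D : P -> R) (tau : R).
Hypotheses (w_sym : forall p q, w p q = w q p) (w_diag : forall p, w p p = 0).
Hypothesis D_ge : forall q, \sum_p w q p ^+ 2 <= D q.
Hypotheses (tau_ge0 : 0 <= tau) (tau_le : 6 * tau ^+ 2 <= 1).

(** A random directed cut keeps a quarter of the weight in the mean: with shifts 1 and -1, [bilin]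
    is minus the total weight at the zero assignment, and minus four times the weight from [A] to
    its complement at signs. *)
Lemma dicut : exists A : {set P},
  (\sum_q (\sum_p w q p ^+ 2) / Num.sqrt (D q)) / 4 <=
  \sum_(q in ~: A) (\sum_(p in A) w q p ^+ 2) / Num.sqrt (D q).
Proof.
pose c p q := w q p ^+ 2 / Num.sqrt (D q).
have c0 p : c p p = 0 by rewrite /c w_diag expr0n mul0r.
have [|e he hle] := @bilin_round c 1 (-1) (fun=> 0) c0; first by move=> _; lra.
exists [set p | e p == 1].
have -> : \sum_q (\sum_p w q p ^+ 2) / Num.sqrt (D q) = - bilin c 1 (-1) (fun=> 0).
  rewrite /bilin exchange_big -sumrN; apply: eq_bigr => q _ /=.
  by rewrite mulr_suml -sumrN; apply: eq_bigr => p _; rewrite /c; ring.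
suff -> : \sum_(q in ~: [set p | e p == 1])
     (\sum_(p in [set p | e p == 1]) w q p ^+ 2) / Num.sqrt (D q) =
   - bilin c 1 (-1) e / 4 by lra.
rewrite /bilin exchange_big -sumrN mulr_suml big_mkcond; apply: eq_bigr => q _ /=.
rewrite mulr_suml big_mkcond /= !inE -sumrN mulr_suml.
have N1 : (-1 == 1 :> R) = false by apply/eqP; lra.
case: (he q) => ->; rewrite ?eqxx ?N1 /=.
  by rewrite big1 // => p _; ring.
apply: eq_bigr => p _; rewrite inE /c; set i := (Num.sqrt _)^-1.
by case: (he p) => ->; rewrite ?eqxx ?N1; field.
Qed.


(** The field at [q] created by random signs has second moment at most [D q]; this scaling reduces
    it to at most [tau ^+ 2]. *)
Let t q := tau / Num.sqrt (D q).

Lemma D_ge0 q : 0 <= D q.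
Proof. by apply: le_trans (D_ge q); apply: sumr_ge0 => p _; apply: sqr_ge0. Qed.

Lemma t_ge0 q : 0 <= t q.
Proof. by rewrite /t divr_ge0 ?sqrtr_ge0. Qed.

Lemma t_sigma (A : {set P}) q : t q ^+ 2 * \sum_(p in A) w q p ^+ 2 <= tau ^+ 2.
Proof.
have hA : \sum_(p in A) w q p ^+ 2 <= D q.
  apply: le_trans (D_ge q); rewrite [X in _ <= X](bigID (mem A)) /= lerDl.
  by apply: sumr_ge0 => p _; apply: sqr_ge0.
have [D0|D0] := eqVneq (D q) 0.
  by rewrite /t D0 sqrtr0 invr0 mulr0 expr0n mul0r sqr_ge0.
have Dp : 0 < D q by rewrite lt_neqAle eq_sym D0 D_ge0.
rewrite /t expr_div_n sqr_sqrtr ?D_ge0 // mulrAC ler_pdivrMr //.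
by rewrite ler_wpM2l ?sqr_ge0.
Qed.

(* Outside [A] each variable is set to a clipped multiple of minus the field
   created by random signs on [A]; two such variables are correlated only
   through their common neighbours. *)
Lemma quadratic_form_signs : exists2 e : P -> R, (forall p, e p = 1 \/ e p = -1) &
  \sum_p \sum_q w p q * e p * e q <=
    tau ^+ 2 * (\sum_q \sum_r \sum_p
       `|w q r| * `|w q p| * `|w r p| / (Num.sqrt (D q) * Num.sqrt (D r))) -
    tau / 4 * (\sum_q (\sum_p w q p ^+ 2) / Num.sqrt (D q)).
Proof.
have [A hA] := dicut.
(* [S q] is the field at [q] coming from [A] alone, and [ext] the fractional assignment that will be
   rounded. *)
pose u q p : R := if p \in A then w q p else 0.
pose S q z : R := \sum_p u q p * z p.
pose ext z q : R := if q \in A then z q else - clip (t q * S q z).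
pose Q z : R := \sum_p \sum_q w p q * z p * z q.
pose z0 : P -> R := fun=> 0.
have S0 q : \sum_p u q p * z0 p = 0 by apply: big1 => p _; rewrite mulr0.
pose l := enum A.
have ul : uniq l by exact: enum_uniq.
have z0l p : p \in l -> z0 p = 0 by [].
have sumu (F : R -> R -> R) q r : F 0 0 = 0 ->
   \sum_(c <- [seq (u q p, u r p) | p <- l]) F c.1 c.2 =
   \sum_(p in A) F (w q p) (w r p).
  move=> F0; rewrite big_map big_enum /=; apply: eq_bigr => p pA.
  by rewrite /u pA.
have bigA (F : P -> R) : \sum_p F p = \sum_(p in A) F p + \sum_(p in ~: A) F p.
  by rewrite (bigID (mem A)) /=; congr (_ + _); apply: eq_bigl => p; rewrite inE.
have QE z : Q (ext z) = \sum_(p in A) \sum_(q in A) w p q * (z p * z q) +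
    (-2) * (\sum_(q in ~: A) S q z * clip (t q * S q z)) +
    \sum_(q in ~: A) \sum_(r in ~: A)
       w q r * (clip (t q * S q z) * clip (t r * S r z)).
  have cross : \sum_(q in ~: A) \sum_(p in A) w q p * ext z q * ext z p =
      - (\sum_(q in ~: A) S q z * clip (t q * S q z)).
    rewrite -sumrN; apply: eq_bigr => q; rewrite inE => /negbTE qA.
    have -> : ext z q = - clip (t q * S q z) by rewrite /ext qA.
    set c := clip _.
    rewrite /S mulr_suml -sumrN big_mkcond; apply: eq_bigr => p _.
    by rewrite /u /ext; case: ifP => pA; rewrite ?pA; ring.
  have split2 (B : {set P}) : \sum_(p in B) \sum_q w p q * ext z p * ext z q =
      \sum_(p in B) \sum_(q in A) w p q * ext z p * ext z q +
      \sum_(p in B) \sum_(q in ~: A) w p q * ext z p * ext z q.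
    by rewrite -big_split; apply: eq_bigr => p _; rewrite [LHS]bigA.
  rewrite /Q [LHS]bigA !split2.
  have -> : \sum_(p in A) \sum_(q in ~: A) w p q * ext z p * ext z q =
      - (\sum_(q in ~: A) S q z * clip (t q * S q z)).
    rewrite exchange_big -cross /=; apply: eq_bigr => q _; apply: eq_bigr => p _.
    by rewrite w_sym mulrAC.
  rewrite cross.
  have -> : \sum_(p in A) \sum_(q in A) w p q * ext z p * ext z q =
      \sum_(p in A) \sum_(q in A) w p q * (z p * z q).
    by apply: eq_bigr => p pA; apply: eq_bigr => q qA; rewrite /ext pA qA mulrA.
  have -> : \sum_(p in ~: A) \sum_(q in ~: A) w p q * ext z p * ext z q =
     \sum_(q in ~: A) \sum_(r in ~: A) w q r * (clip (t q * S q z) * clip (t r * S r z)).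
    apply: eq_bigr => p; rewrite inE => /negbTE pA; apply: eq_bigr => q.
    by rewrite inE => /negbTE qA; rewrite /ext pA qA; ring.
  by ring.
(* Distinct signs are uncorrelated; coordinates are written as linear forms with delta coefficients
   so that [avg_rad] applies. *)
have hAA : avg l (fun z => \sum_(p in A) \sum_(q in A) w p q * (z p * z q)) z0 = 0.
  rewrite avg_sum big1 // => p _; rewrite avg_sum big1 // => q _.
  rewrite avg_scale; have [->|pq] := eqVneq p q; first by rewrite w_diag mul0r.
  have dE z r : \sum_s (s == r)%:R * z s = z r :> R.
    rewrite (bigD1 r) //= eqxx mul1r big1 ?addr0 // => s /negbTE ->.
    by rewrite mul0r.
  rewrite (@avg_ext _ _ (fun z =>
    (\sum_s (s == p)%:R * z s) * (\sum_s (s == q)%:R * z s))); last first.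
    by move=> z; rewrite !dE.
  rewrite (@avg_rad *%R) // rad_mul !dE mul0r add0r big_map big1 ?mulr0 // => s _ /=.
  have [->|_] := eqVneq s p; last by rewrite mul0r.
  by rewrite (negbTE pq) mulr0.
(* With [sg] the variance of the field, [mul_clip_ge] gives at least
   [t q * sg - 3 * t q ^+ 3 * sg ^+ 2]; since [t q ^+ 2 * sg <= tau ^+ 2 <= 1 / 6], at most half of
   the first term is lost. *)
have hAB q : t q / 2 * (\sum_(p in A) w q p ^+ 2) <= 
    avg l (fun z => S q z * clip (t q * S q z)) z0.
  rewrite (@avg_rad (fun x _ => x * clip (t q * x)) (u q) (u q)) // !S0.
  set sg := \sum_(p in A) _.
  have h2 : \sum_(c <- [seq (u q p, u q p) | p <- l]) c.1 ^+ 2 = sg.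
    by rewrite (sumu (fun x _ => x ^+ 2)) // expr0n.
  have tq := t_ge0 q.
  have : rad [seq (u q p, u q p) | p <- l]
      (fun x _ => t q * x ^+ 2 + (- t q ^+ 3) * x ^+ 4) 0 0 <=
     rad [seq (u q p, u q p) | p <- l] (fun x _ => x * clip (t q * x)) 0 0.
    apply: rad_le => x _; have [t0|t0] := eqVneq (t q) 0.
      by rewrite t0 !mul0r /clip minEle maxEle expr0n /=; do !case: ifP => /=; lra.
    have tp : 0 < t q by rewrite lt_neqAle eq_sym t0.
    rewrite -(ler_pM2l tp) [leRHS]mulrA; apply: le_trans (mul_clip_ge _).
    by rewrite le_eqVlt; apply/orP; left; apply/eqP; ring.
  rewrite rad_lin rad_pow2 h2 expr0n /= add0r => hh; apply: le_trans hh.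
  have := rad_pow4 [seq (u q p, u q p) | p <- l] 0 0; rewrite h2.
  have := t_sigma A q; rewrite -/sg.
  have sg0 : 0 <= sg by apply: sumr_ge0 => p _; apply: sqr_ge0.
  set X := rad _ _ _ _ => hs; rewrite !expr0n /= mulr0 mul0r !add0r => hX.
  have : t q ^+ 3 * X <= t q ^+ 3 * (3 * sg ^+ 2) by rewrite ler_wpM2l // exprn_ge0.
  have : t q * sg * (t q ^+ 2 * sg) <= t q * sg * (1 / 6).
    apply: ler_wpM2l; first exact: mulr_ge0.
    by apply: le_trans hs _; move: tau_le; lra.
  lra.
have hBB q r : avg l (fun z => w q r * (clip (t q * S q z) * clip (t r * S r z))) z0
    <= `|w q r| * (t q * t r * \sum_p `|w q p| * `|w r p|).
  rewrite avg_scale; apply: le_trans (ler_norm _) _.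
  rewrite normrM ler_wpM2l //.
  rewrite (@avg_rad (fun x y => clip (t q * x) * clip (t r * y)) (u q) (u r)) // !S0.
  have lip i x y : `|clip (t i * x) - clip (t i * y)| <= t i * `|x - y|.
    by apply: le_trans (clip_lip _ _) _; rewrite -mulrBr normrM (ger0_norm (t_ge0 i)).
  have := rad_cov [seq (u q p, u r p) | p <- l] 0 0 (t_ge0 q) (t_ge0 r) (lip q) (lip r).
  (* The clipped field is odd in the signs, so its mean vanishes and the mean product is a
     covariance. *)
  have -> : rad [seq (u q p, u r p) | p <- l] (fun x _ => clip (t q * x)) 0 0 = 0.
    have hodd (x _ : R) : clip (t q * - x) = - clip (t q * x) by rewrite mulrN clipN.
    have := rad_odd [seq (u q p, u r p) | p <- l] 0 0 hodd.
    by rewrite !oppr0; lra.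
  rewrite mul0r subr0 => /le_trans; apply.
  apply: ler_wpM2l; first by rewrite mulr_ge0 ?t_ge0.
  have hF : `|0 : R| * `|0 : R| = 0 by rewrite normr0 mulr0.
  rewrite (sumu (fun x y => `|x| * `|y|) q r hF).
  rewrite [X in _ <= X](bigID (mem A)) /= lerDl.
  by apply: sumr_ge0 => p _; apply: mulr_ge0.
have [e0 [he0 _ hQ]] := avg_exists l (fun z => Q (ext z)) z0.
have ext1 p : -1 <= ext e0 p <= 1.
  rewrite /ext; case: ifP => pA; last first.
    by have := clip_bound (t p * S p e0); lra.
  by case: (he0 p); rewrite ?mem_enum // => ->; lra.
have [e he hle] := bilin_round 0 0 w_diag ext1; exists e => //.
have bilinE z : bilin w 0 0 z = Q z.
  by apply: eq_bigr => p _; apply: eq_bigr => q _; rewrite !add0r.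
rewrite !bilinE in hle; apply: le_trans hle _; apply: le_trans hQ _.
rewrite (avg_ext _ _ QE) !avg_add avg_scale hAA add0r !avg_sum addrC.
rewrite (eq_bigr _ (fun q _ => avg_sum _ _ _ _ _)).
(* The gain [tau / 4] combines the two orders of a cross term, the half kept by clipping and the
   quarter kept by the cut. *)
apply: lerD; last first.
  have : \sum_(q in ~: A) t q / 2 * (\sum_(p in A) w q p ^+ 2) <=
     \sum_(q in ~: A) avg l (fun z => S q z * clip (t q * S q z)) z0.
    by apply: ler_sum => q _; apply: hAB.
  have -> : \sum_(q in ~: A) t q / 2 * (\sum_(p in A) w q p ^+ 2) =
    tau / 2 * \sum_(q in ~: A) (\sum_(p in A) w q p ^+ 2) / Num.sqrt (D q).
    by rewrite mulr_sumr; apply: eq_bigr => q _; rewrite /t; ring.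
  have := ler_wpM2l tau_ge0 hA; lra.
rewrite mulr_sumr (bigA (fun q => _ * _)) -[X in X <= _]add0r; apply: lerD.
  apply: sumr_ge0 => q _; rewrite mulr_ge0 ?sqr_ge0 //; do 2 apply: sumr_ge0 => ? _.
  by rewrite divr_ge0 ?mulr_ge0 ?sqrtr_ge0.
apply: ler_sum => q _; rewrite mulr_sumr (bigA (fun q => _ * _)) -[X in X <= _]add0r.
apply: lerD.
  apply: sumr_ge0 => r _; rewrite mulr_ge0 ?sqr_ge0 //; apply: sumr_ge0 => ? _.
  by rewrite divr_ge0 ?mulr_ge0 ?sqrtr_ge0.
apply: ler_sum => r _; apply: le_trans (hBB q r) _.
rewrite !mulr_sumr; apply: ler_sum => p _; rewrite /t invfM.
by rewrite le_eqVlt; apply/orP; left; apply/eqP; ring.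
Qed.

End SignedQuadraticForm.

(** * Perfect pairings of a finite set *)

Section Pairings.
Variable V : finType.
Implicit Types (s : {perm V}) (x y z : V) (c : seq (V * V)).

(** Encoding perfect matchings as fixed-point-free involutions lets permutations act on them by
    conjugation. *)
Definition pairings : {set {perm V}} :=
  [set s : {perm V} | [forall x, (s (s x) == x) && (s x != x)]].

Lemma pairingsP s :
  reflect ((forall x, s (s x) = x) /\ (forall x, s x != x)) (s \in pairings).
Proof.
rewrite inE; apply: (iffP forallP) => [h|[h1 h2] x]; last by rewrite h1 eqxx h2.
by split=> x; have /andP[/eqP] := h x.
Qed.

Lemma conj_tpermE s y z x : (s ^ tperm y z)%g x = tperm y z (s (tperm y z x)).
Proof. by rewrite -{1}(tpermK y z x) permJ. Qed.

Lemma pairings_conj s y z : s \in pairings -> (s ^ tperm y z)%g \in pairings.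
Proof.
move=> /pairingsP[h1 h2]; apply/pairingsP; split=> x; rewrite !conj_tpermE.
  by rewrite tpermK h1 tpermK.
by rewrite -{2}(tpermK y z x) (inj_eq perm_inj) h2.
Qed.

Definition matches c s := all (fun p => s p.1 == p.2) c.

Definition endpoints c := flatten [seq [:: p.1; p.2] | p <- c].

Lemma size_endpoints c : size (endpoints c) = (2 * size c)%N.
Proof. by elim: c => //= p c; rewrite /endpoints /= => ->; lia. Qed.

(* Conjugation by transpositions moves the partner of [x] freely over the
   points not involved in the other constraints. *)
Lemma pairings_switch x y c : uniq (endpoints ((x, y) :: c)) ->
  ((#|V| - (1 + 2 * size c)) * #|[set s in pairings | matches ((x, y) :: c) s]| <=
   #|[set s in pairings | matches c s]|)%N.
Proof.
rewrite /endpoints /= -/(endpoints c) inE negb_or => /and3P[/andP[xy xc] yc uc].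
(* The possible new partners of [x]; [y] itself is one of them, with trivial transposition. *)
pose Z := ~: [set z in x :: endpoints c].
have hZ : (#|V| - (1 + 2 * size c) <= #|Z|)%N.
  have := cardsC [set z in x :: endpoints c]; rewrite -/Z.
  have : (#|[set z in x :: endpoints c]| <= 1 + 2 * size c)%N.
    by rewrite cardsE (leq_trans (card_size _)) //= size_endpoints.
  lia.
apply: leq_trans (leq_mul hZ (leqnn _)) _.
rewrite -[X in (X * _)%N]sum1_card big_distrl /=.
rewrite -[X in (_ <= X)%N]sum1_card.
rewrite [X in (_ <= X)%N](bigID (fun s : {perm V} => s x \in Z)) /=.
apply: leq_trans (leq_addr _ _).
(* Pairings are classified by the partner [z] of [x]; conjugation by [tperm y z] embeds those with
   [s x = y] into each class. *)
rewrite (partition_big (fun s : {perm V} => s x) (mem Z)) /=; last by move=> s /andP[].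
apply: leq_sum => z zZ; rewrite mul1n.
rewrite -(card_imset _ (conjg_inj (tperm y z))) sum1dep_card.
apply: subset_leq_card; apply/subsetP => t /imsetP[s hs ->] {t}.
move: hs; rewrite [s \in _]inE => /andP[hs /andP[/= /eqP sxy sc]]; rewrite inE.
move: (zZ); rewrite !inE negb_or => /andP[zx zc].
have tx : tperm y z x = x by rewrite tpermD // eq_sym.
have -> : (s ^ tperm y z)%g x = z by rewrite conj_tpermE tx sxy tpermL.
have := pairings_conj y z hs; rewrite inE => ->.
rewrite (negbTE zx) (negbTE zc) eqxx !andbT /=; apply/allP => p pc.
have hp1 : p.1 \in endpoints c.
  by apply/flattenP; exists [:: p.1; p.2]; [apply: map_f|rewrite inE eqxx].
have hp2 : p.2 \in endpoints c.
  by apply/flattenP; exists [:: p.1; p.2]; [apply: map_f|rewrite !inE eqxx orbT].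
have td v : v \in endpoints c -> tperm y z v = v.
  by move=> vc; rewrite tpermD //; [apply: contraNneq yc|apply: contraNneq zc] => ->.
by rewrite conj_tpermE (td _ hp1) (eqP (allP sc _ pc)) td.
Qed.

(** Iterates the switching bound: the size hypothesis makes each factor [n - (1 + 2 * size c)] at
    least [n / 2], so [k] prescribed pairs have probability at most [(2 / n) ^ k]. *)
Lemma card_matches c : uniq (endpoints c) -> (4 * size c <= #|V| + 2)%N ->
  (#|V| ^ size c * #|[set s in pairings | matches c s]| <= 2 ^ size c * #|pairings|)%N.
Proof.
elim: c => [|[x y] c IH] u hs.
  by rewrite !expn0 !mul1n subset_leq_card //; apply/subsetP => s; rewrite inE => /andP[].
have h := pairings_switch u.
have uc : uniq (endpoints c) by move: u; rewrite /endpoints /= => /and3P[].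
have {}IH : (#|V| ^ size c * #|[set s in pairings | matches c s]| <=
    2 ^ size c * #|pairings|)%N.
  by apply: IH => //; move: hs => /=; lia.
rewrite [size (_ :: _)]/= !expnS; set N := #|V| in h hs IH *.
set k := #|[set s in pairings | matches (_ :: _) s]| in h *.
set k' := #|[set s in pairings | matches c s]| in h IH.
have h1 : (N * k <= 2 * k')%N.
  apply: leq_trans (_ : (2 * ((N - (1 + 2 * size c)) * k) <= _)%N); last by rewrite leq_mul2l.
  by rewrite mulnA leq_mul2r; apply/orP; right; move: hs => /=; lia.
rewrite [(N * _)%N]mulnC -mulnA -[(2 * _ * _)%N]mulnA.
apply: leq_trans (leq_mul (leqnn _) h1) _.
by rewrite mulnCA leq_mul2l IH orbT.
Qed.

Lemma pairings_exists : ~~ odd #|V| -> exists s, s \in pairings.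
Proof.
move=> ev; pose mate (i : nat) := if odd i then i.-1 else i.+1.
have mate_lt (i : 'I_#|V|) : (mate i < #|V|)%N.
  have := ltn_ord i; move: (nat_of_ord i) => j jV; rewrite /mate; case: ifP => oj; first by lia.
  move: jV; rewrite leq_eqVlt => /orP[/eqP e|//].
  by move: ev; rewrite -e /= oj.
have mateK i : mate (mate i) = i.
  rewrite /mate; case: (boolP (odd i)) => oi; last by rewrite /= oi.
  by case: i oi => //= i; case: (odd i).
pose f x := enum_val (Ordinal (mate_lt (enum_rank x))).
have fK : involutive f.
  move=> x; rewrite /f; apply: (canLR enum_rankK); apply: val_inj => /=.
  by rewrite enum_valK /= mateK.
exists (perm (inv_inj fK)); apply/pairingsP; split=> x; rewrite !permE ?fK //.
apply/eqP => /(congr1 enum_rank); rewrite enum_valK => /(congr1 val) /=.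
by rewrite /mate; case: (boolP (odd _)) => o; move: o; case: (nat_of_ord _) => //= *; lia.
Qed.

Lemma pairings_edge x y : x != y -> ~~ odd #|V| -> exists2 s, s \in pairings & s x = y.
Proof.
move=> xy /pairings_exists[s hs]; exists (s ^ tperm (s x) y)%g; first exact: pairings_conj.
have /pairingsP[_ h] := hs.
have tx : tperm (s x) y x = x by rewrite tpermD ?h // eq_sym.
by rewrite conj_tpermE tx tpermL.
Qed.

End Pairings.

(** * Expected number of triangles between pairs *)

Section RandomPairing.
Variables (R : rcfType) (V : finType).
Implicit Types (s : {perm V}) (x y z : V).
Local Notation n := (#|V|%:R : R).
Local Notation M := (pairings V).

Definition apart s x y z := uniq [:: x; s x; y; s y; z; s z].

Lemma sum_delta (F : V -> R) x : \sum_y (x == y)%:R * F y = F x.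
Proof.
rewrite (bigD1 x) //= eqxx mul1r big1 ?addr0 // => y; rewrite eq_sym => /negbTE ->.
by rewrite mul0r.
Qed.

Lemma sum_const (c : R) : \sum_(x : V) c = n * c.
Proof. by rewrite sumr_const mulr_natl. Qed.

Lemma sum_pairings_matches (c : seq (V * V)) : (0 < #|V|)%N ->
  uniq (endpoints c) -> (4 * size c <= #|V| + 2)%N ->
  \sum_(s in M) (matches c s)%:R <= 2 ^+ size c * #|M|%:R / n ^+ size c.
Proof.
move=> V0 uc hc; have -> : \sum_(s in M) (matches c s)%:R =
    #|[set s in M | matches c s]|%:R :> R.
  rewrite -sum1_card natr_sum big_mkcond [RHS]big_mkcond /=.
  apply: eq_bigr => s _; rewrite [s \in [set _ in _ | _]]inE.
  by case: (s \in M) => //; case: matches.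
rewrite ler_pdivlMr ?exprn_gt0 ?ltr0n // -!natrX -!natrM ler_nat mulnC.
exact: card_matches.
Qed.

(** The partners are replaced by free variables, each prescribed triple having probability at most
    [8 / n ^ 3]. Apartness makes the six endpoints distinct, and 10 vertices are what three
    constraints require. *)
Lemma avg_apart (g : V -> V -> V -> V -> V -> V -> R) : (10 <= #|V|)%N ->
  (forall x y z x' y' z', 0 <= g x y z x' y' z') ->
  \sum_(s in M) \sum_x \sum_y \sum_z (apart s x y z)%:R * g x y z (s x) (s y) (s z) <=
  (8 * #|M|%:R / n ^+ 3) * \sum_x \sum_y \sum_z \sum_x' \sum_y' \sum_z' g x y z x' y' z'.
Proof.
move=> V10 g0.
have E s x y z : (apart s x y z)%:R * g x y z (s x) (s y) (s z) =
    \sum_x' \sum_y' \sum_z' (apart s x y z)%:R *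
      ((s x == x')%:R * ((s y == y')%:R * ((s z == z')%:R * g x y z x' y' z'))).
  rewrite -(sum_delta (fun x' => g x y z x' (s y) (s z))) mulr_sumr; apply: eq_bigr => x' _.
  rewrite -(sum_delta (fun y' => g x y z x' y' (s z))) !mulr_sumr; apply: eq_bigr => y' _.
  by rewrite -(sum_delta (fun z' => g x y z x' y' z')) !mulr_sumr.
under eq_bigr => s _ do under eq_bigr => x _ do under eq_bigr => y _ do
  under eq_bigr => z _ do rewrite E.
rewrite exchange_big /= mulr_sumr; apply: ler_sum => x _.
rewrite exchange_big /= mulr_sumr; apply: ler_sum => y _.
rewrite exchange_big /= mulr_sumr; apply: ler_sum => z _.
rewrite exchange_big /= mulr_sumr; apply: ler_sum => x' _.
rewrite exchange_big /= mulr_sumr; apply: ler_sum => y' _.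
rewrite exchange_big /= mulr_sumr; apply: ler_sum => z' _.
pose c := [:: (x, x'); (y, y'); (z, z')].
have V0 : (0 < #|V|)%N by apply: leq_trans V10.
have [uc|/negbTE uc] := boolP (uniq (endpoints c)).
  have hs : (4 * size c <= #|V| + 2)%N by rewrite (@leq_trans (10 + 2)) // leq_add2r.
  have hc := sum_pairings_matches V0 uc hs.
  apply: le_trans (_ : (\sum_(s in M) (matches c s)%:R) * g x y z x' y' z' <= _).
    rewrite mulr_suml; apply: ler_sum => s _; rewrite /matches /= andbT.
    by case: apart; case: eqP; case: eqP; case: eqP => * /=; rewrite ?mul1r ?mul0r.
  have e8 : 2 ^+ 3 = 8 :> R by ring.
  by apply: ler_wpM2r; [exact: g0 | move: hc; rewrite /c /= e8].
rewrite big1; first by rewrite mulr_ge0 // divr_ge0 ?exprn_ge0 // mulr_ge0.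
move=> s _; case: (s x =P x') => [ex|_]; last by rewrite mul0r mulr0.
case: (s y =P y') => [ey|_]; last by rewrite mul0r !mulr0.
case: (s z =P z') => [ez|_]; last by rewrite mul0r !mulr0.
by move: uc; rewrite /endpoints /= -ex -ey -ez /apart /= => ->; rewrite mul0r.
Qed.

(** * Degree sums for codegrees at most one *)

Variable a : rel V.
Hypotheses (a_sym : symmetric a) (a_irr : irreflexive a).

Definition edge x y : R := (a x y)%:R.
Definition deg x : R := \sum_y edge x y.
Local Notation A := edge.
Local Notation dg := deg.
Definition vol : R := \sum_x dg x.

Hypothesis codeg_le1 : forall x y, x != y -> \sum_z A x z * A y z <= 1.
Hypothesis deg_ge2 : forall x y, a x y -> 2 <= dg x.

Lemma edge_sym x y : A x y = A y x. Proof. by rewrite /edge a_sym. Qed.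
Lemma edge_ge0 x y : 0 <= A x y. Proof. exact: ler0n. Qed.
Lemma edge_irr x : A x x = 0. Proof. by rewrite /edge a_irr. Qed.
Lemma edge_le1 x y : A x y <= 1. Proof. by rewrite /edge; case: a. Qed.
Lemma edge_sqr x y : A x y ^+ 2 = A x y.
Proof. by rewrite /edge; case: a; rewrite ?expr1n ?expr0n. Qed.
Lemma deg_ge0 x : 0 <= dg x. Proof. by apply: sumr_ge0 => y _; apply: edge_ge0. Qed.
Lemma degE x : dg x = \sum_y A y x.
Proof. by apply: eq_bigr => y _; rewrite edge_sym. Qed.
Lemma deg_le x : dg x <= n.
Proof.
by apply: le_trans (ler_sum _ (fun y _ => edge_le1 x y)) _; rewrite sum_const mulr1.
Qed.
Lemma vol_ge0 : 0 <= vol. Proof. by apply: sumr_ge0 => x _; apply: deg_ge0. Qed.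

(** Counts paths of length two by their ends: distinct ends have at most one common neighbour, and
    equal ends contribute a degree, at most [n]. *)
Lemma sum_deg_sqr : \sum_x dg x ^+ 2 <= 2 * n ^+ 2.
Proof.
have -> : \sum_x dg x ^+ 2 = \sum_y \sum_z \sum_x A y x * A z x.
  under eq_bigr do rewrite expr2 {1}/deg mulr_suml.
  rewrite exchange_big; apply: eq_bigr => y _ /=.
  rewrite exchange_big; apply: eq_bigr => x _ /=.
  by rewrite degE mulr_sumr; apply: eq_bigr => z _; rewrite edge_sym.
apply: le_trans (_ : \sum_y \sum_z (1 + (y == z)%:R * n) <= _).
  apply: ler_sum => y _; apply: ler_sum => z _; have [->|yz] := eqVneq y z.
    rewrite mul1r; apply: le_trans (_ : n <= _); last lra.
    apply: le_trans (deg_le z); apply: ler_sum => x _.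
    by rewrite -expr2 edge_sqr.
  by rewrite mul0r addr0 codeg_le1.
under eq_bigr do rewrite big_split /= sum_delta.
by rewrite big_split /= !sum_const; lra.
Qed.

(** Cauchy-Schwarz, from the nonnegative sum of all [(dg x - dg y) ^+ 2]. *)
Lemma vol_sqr : vol ^+ 2 <= n * \sum_x dg x ^+ 2.
Proof.
have : 0 <= \sum_x \sum_y (dg x - dg y) ^+ 2.
  by do 2! apply: sumr_ge0 => ? _; apply: sqr_ge0.
suff -> : \sum_x \sum_y (dg x - dg y) ^+ 2 = 2 * (n * (\sum_x dg x ^+ 2) - vol ^+ 2) by lra.
have -> : \sum_x \sum_y (dg x - dg y) ^+ 2 =
  \sum_x (n * dg x ^+ 2 + (\sum_y dg y ^+ 2) - 2 * dg x * vol).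
  apply: eq_bigr => x _; rewrite /vol mulr_sumr -sumrN -sum_const -!big_split /=.
  by apply: eq_bigr => y _; ring.
rewrite !big_split /= sumrN -mulr_sumr sum_const -mulr_suml -mulr_sumr -/vol; ring.
Qed.

(* Transition probability of the random walk, with value [0] at isolated points. *)
Definition step x y : R := A x y / dg x.
Local Notation B := step.
Lemma step_ge0 x y : 0 <= B x y. Proof. by rewrite divr_ge0 ?edge_ge0 ?deg_ge0. Qed.
Lemma sum_step x : \sum_y B x y <= 1.
Proof.
rewrite -mulr_suml -/(deg x); have [->|h] := eqVneq (dg x) 0; first by rewrite mul0r.
by rewrite divff.
Qed.
Lemma sum_sum_step : \sum_x \sum_y B x y <= n.
Proof. by apply: le_trans (ler_sum _ (fun x _ => sum_step x)) _; rewrite sum_const mulr1. Qed.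


Definition sum6 (g : V -> V -> V -> V -> V -> V -> R) : R :=
  \sum_x \sum_y \sum_z \sum_x' \sum_y' \sum_z' g x y z x' y' z'.

Lemma sum6D g g' : sum6 (fun x y z x' y' z' => g x y z x' y' z' + g' x y z x' y' z') =
  sum6 g + sum6 g'.
Proof.
rewrite /sum6; do 5 (rewrite -big_split; apply: eq_bigr => ? _ /=).
by rewrite -big_split.
Qed.

Local Notation S2 := (\sum_x dg x ^+ 2).

Lemma n_ge0 : 0 <= n. Proof. exact: ler0n. Qed.

Lemma sum_edge_deg : \sum_x \sum_y A x y * dg y = S2.
Proof.
rewrite exchange_big; apply: eq_bigr => y _ /=.
by rewrite -mulr_suml -degE expr2.
Qed.

Lemma S2_ge0 : 0 <= S2. Proof. by apply: sumr_ge0 => x _; apply: sqr_ge0. Qed.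

(* The digits tell which of [y], [z], [x] are left through their partners when
   closing the triangle [x, y, z]. *)
Lemma sum6_010 : sum6 (fun x y z x' y' z' => A x y * A y z * B x z') <= n ^+ 2 * S2.
Proof.
rewrite /sum6.
have -> : n ^+ 2 * S2 = \sum_x \sum_y \sum_z \sum_(x' : V) \sum_(y' : V) A x y * A y z * 1.
  rewrite -sum_edge_deg mulr_sumr; apply: eq_bigr => x _.
  rewrite mulr_sumr; apply: eq_bigr => y _; rewrite /deg !mulr_sumr.
  by apply: eq_bigr => z _; rewrite !sum_const; ring.
do 5 (apply: ler_sum => ? _).
by rewrite -mulr_sumr ler_wpM2l ?mulr_ge0 ?edge_ge0 ?sum_step.
Qed.

Lemma sum6_100 : sum6 (fun x y z x' y' z' => B x y * (A y' z * A z x)) <= n ^+ 2 * S2.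
Proof.
rewrite /sum6.
have -> : \sum_x \sum_y \sum_z \sum_(x' : V) \sum_y' \sum_(z' : V) B x y * (A y' z * A z x) =
    n ^+ 2 * \sum_x (\sum_y B x y) * (\sum_z A x z * dg z).
  rewrite mulr_sumr; apply: eq_bigr => x _.
  rewrite mulrCA mulr_suml; apply: eq_bigr => y _.
  rewrite !mulr_sumr; apply: eq_bigr => z _.
  rewrite sum_const degE !mulr_sumr; apply: eq_bigr => y' _.
  by rewrite sum_const (edge_sym z x); ring.
rewrite -sum_edge_deg ler_wpM2l ?exprn_ge0 ?n_ge0 //; apply: ler_sum => x _.
rewrite ler_piMl ?sum_step //; apply: sumr_ge0 => z _.
by rewrite mulr_ge0 ?edge_ge0 ?deg_ge0.
Qed.

Lemma sum6_011 : sum6 (fun x y z x' y' z' => A x y * A y z * B x' z') <= n ^+ 2 * S2.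
Proof.
rewrite /sum6.
have -> : \sum_x \sum_y \sum_z \sum_x' \sum_(y' : V) \sum_z' A x y * A y z * B x' z' =
    S2 * (n * \sum_x \sum_y B x y).
  rewrite -sum_edge_deg mulr_suml; apply: eq_bigr => x _.
  rewrite mulr_suml; apply: eq_bigr => y _.
  rewrite /deg mulr_sumr mulr_suml; apply: eq_bigr => z _.
  rewrite !mulr_sumr; apply: eq_bigr => x' _.
  by rewrite sum_const !mulr_sumr; apply: eq_bigr => z' _; ring.
rewrite mulrC ler_wpM2r ?S2_ge0 // expr2 ler_wpM2l ?n_ge0 //; exact: sum_sum_step.
Qed.

Lemma sum6_101 : sum6 (fun x y z x' y' z' => B x y * (A y' z * A z x')) <= n ^+ 2 * S2.
Proof.
rewrite /sum6.
have -> : \sum_x \sum_y \sum_z \sum_x' \sum_y' \sum_(z' : V) B x y * (A y' z * A z x') =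
    (\sum_x \sum_y B x y) * (n * S2).
  rewrite mulr_suml; apply: eq_bigr => x _; rewrite mulr_suml; apply: eq_bigr => y _.
  rewrite !mulr_sumr; apply: eq_bigr => z _.
  rewrite expr2 {1}/deg mulr_suml !mulr_sumr; apply: eq_bigr => x' _.
  rewrite degE !mulr_sumr; apply: eq_bigr => y' _.
  by rewrite sum_const; ring.
rewrite expr2 -[n * n * _]mulrA ler_wpM2r ?mulr_ge0 ?n_ge0 ?S2_ge0 //; exact: sum_sum_step.
Qed.

Lemma n_vol_sqr : n * vol ^+ 2 <= n ^+ 2 * S2.
Proof. by rewrite expr2 -[n * n * _]mulrA ler_wpM2l ?n_ge0 ?vol_sqr. Qed.

Lemma sum6_110 : sum6 (fun x y z x' y' z' => B x y * (A y' z * A z' x)) <= n ^+ 2 * S2.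
Proof.
rewrite /sum6.
have -> : \sum_x \sum_y \sum_z \sum_(x' : V) \sum_y' \sum_z' B x y * (A y' z * A z' x) =
    n * vol * \sum_x (\sum_y B x y) * dg x.
  rewrite mulr_sumr; apply: eq_bigr => x _.
  rewrite mulrCA mulr_suml; apply: eq_bigr => y _.
  have -> : B x y * (n * vol * dg x) = n * (B x y * (vol * dg x)) by ring.
  rewrite /vol mulr_suml !mulr_sumr; apply: eq_bigr => z _.
  rewrite sum_const; congr (_ * _).
  rewrite degE mulr_suml mulr_sumr; apply: eq_bigr => y' _.
  by rewrite degE !mulr_sumr.
apply: le_trans n_vol_sqr; rewrite expr2 mulrA ler_wpM2l ?mulr_ge0 ?n_ge0 ?vol_ge0 //.
by apply: ler_sum => x _; rewrite ler_piMl ?sum_step ?deg_ge0.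
Qed.

Lemma sum6_111 : sum6 (fun x y z x' y' z' => B x y * (A y' z * A z' x')) <= n ^+ 2 * S2.
Proof.
rewrite /sum6.
have -> : \sum_x \sum_y \sum_z \sum_x' \sum_y' \sum_z' B x y * (A y' z * A z' x') =
    (\sum_x \sum_y B x y) * vol ^+ 2.
  rewrite mulr_suml; apply: eq_bigr => x _; rewrite mulr_suml; apply: eq_bigr => y _.
  rewrite expr2 {1}/vol mulr_suml !mulr_sumr; apply: eq_bigr => z _.
  rewrite /vol !mulr_sumr; apply: eq_bigr => x' _.
  rewrite degE mulr_suml !mulr_sumr; apply: eq_bigr => y' _.
  by rewrite degE !mulr_sumr.
apply: le_trans n_vol_sqr; rewrite ler_wpM2r ?sqr_ge0 //; exact: sum_sum_step.
Qed.

(** Plays the role of [D] for the form on pairs; the factor 4 makes it dominate the sum of squared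
    weights at the pair of [x]. *)
Definition pair_deg s x : R := 4 * (dg x + dg (s x)).
Local Notation pdeg := pair_deg.

Lemma edge_div_pair_deg s x y : A x y / pdeg s x <= B x y.
Proof.
rewrite /step /pair_deg; have [->|h] := eqVneq (A x y) 0; first by rewrite !mul0r.
have := deg_ge0 x; have := deg_ge0 (s x) => h1 h2.
have : 0 < dg x.
  move: h; rewrite /edge; case: (boolP (a x y)) => [/deg_ge2|_]; last by rewrite eqxx.
  by lra.
move=> h3; rewrite ler_wpM2l ?edge_ge0 // lef_pV2 ?posrE; lra.
Qed.

Lemma edge_div_pair_deg' s x y : s (s x) = x -> A (s x) y / pdeg s x <= B (s x) y.
Proof.
move=> sK; have -> : pdeg s x = pdeg s (s x) by rewrite /pair_deg sK addrC.
exact: edge_div_pair_deg.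
Qed.

(** Eight of the 64 ways to choose an edge between each two of three pairs; exchanging vertices with
    their partners yields the others. *)
Definition half_triangles s x y z : R := A x y * (A y z + A (s y) z) *
  (A z x + A z (s x) + A (s z) x + A (s z) (s x)).

(** Two of the eight products avoid [s y] and [s z]; codegrees bound them by [2 * n] for every
    pairing. Each of the other six has a free sum of at most [2 * n ^ 4], and the factor [8 / n ^ 3]
    turns them into [96 * n]. *)
Lemma avg_half_triangles : (10 <= #|V|)%N ->
  \sum_(s in M) \sum_x \sum_y \sum_z
    (apart s x y z)%:R * (half_triangles s x y z / pdeg s x) <= 98 * n * #|M|%:R.
Proof.
move=> V10.
have n0 : 0 < n by rewrite ltr0n (leq_trans _ V10).
pose g x y z x' y' z' : R := A x y * A y z * B x z' + (B x y * (A y' z * A z x) +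
  (A x y * A y z * B x' z' + (B x y * (A y' z * A z x') + (B x y * (A y' z * A z' x) +
   B x y * (A y' z * A z' x'))))).
have g0 x y z x' y' z' : 0 <= g x y z x' y' z'.
  by rewrite /g; repeat first [exact: edge_ge0|exact: step_ge0|apply: addr_ge0|apply: mulr_ge0].
have hg := avg_apart V10 g0.
have {}hg : \sum_(s in M) \sum_x \sum_y \sum_z
   (apart s x y z)%:R * g x y z (s x) (s y) (s z) <= 96 * n * #|M|%:R.
  apply: le_trans hg _; rewrite -/(sum6 g) /g !sum6D.
  set t := (X in _ * X <= _).
  have ht : t <= 12 * n ^+ 4.
    have := sum6_010; have := sum6_100; have := sum6_011; have := sum6_101.
    have := sum6_110; have := sum6_111.
    have : n ^+ 2 * S2 <= n ^+ 2 * (2 * n ^+ 2) by rewrite ler_wpM2l ?exprn_ge0 ?sum_deg_sqr ?ltW.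
    rewrite /t; lra.
  have -> : 96 * n * #|M|%:R = 8 * #|M|%:R / n ^+ 3 * (12 * n ^+ 4).
    by field; rewrite lt0r_neq0.
  apply: ler_wpM2l ht; apply: divr_ge0; first by apply: mulr_ge0; apply: ler0n.
  by rewrite exprn_ge0 ?ltW.
suff h s : s \in M -> \sum_x \sum_y \sum_z
    (apart s x y z)%:R * (half_triangles s x y z / pdeg s x) <=
    2 * n + \sum_x \sum_y \sum_z (apart s x y z)%:R * g x y z (s x) (s y) (s z).
  apply: le_trans (ler_sum _ h) _; rewrite big_split /= sumr_const -mulr_natr; lra.
move=> /pairingsP[sK _].
apply: le_trans (_ : \sum_x \sum_y \sum_z ((apart s x y z)%:R *
   (B x y * (A y z * A x z + A y z * A (s x) z)) +
   (apart s x y z)%:R * g x y z (s x) (s y) (s z)) <= _).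
  apply: ler_sum => x _; apply: ler_sum => y _; apply: ler_sum => z _.
  rewrite -mulrDr ler_wpM2l ?ler0n //.
  have hx v := edge_div_pair_deg s x v; have hs v := edge_div_pair_deg' v (sK x).
  move: hx hs; set i := (pdeg s x)^-1 => hx hs.
  have -> : half_triangles s x y z * i =
    (A x y * i) * (A y z * A x z + A y z * A (s x) z) +
    (A x y * A y z * (A x (s z) * i) + ((A x y * i) * (A (s y) z * A z x) +
    (A x y * A y z * (A (s x) (s z) * i) + ((A x y * i) * (A (s y) z * A z (s x)) +
    ((A x y * i) * (A (s y) z * A (s z) x) +
     (A x y * i) * (A (s y) z * A (s z) (s x))))))).
    rewrite /half_triangles (edge_sym (s z) (s x)) (edge_sym (s z) x).
    rewrite (edge_sym z (s x)) (edge_sym z x).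
    by ring.
  rewrite /g; do ?apply: lerD;
    first [apply: ler_wpM2r; last exact: hx | apply: ler_wpM2l; last first];
    repeat first [exact: hx|exact: hs|exact: edge_ge0|apply: addr_ge0|apply: mulr_ge0].
have -> : \sum_x \sum_y \sum_z ((apart s x y z)%:R *
   (B x y * (A y z * A x z + A y z * A (s x) z)) +
   (apart s x y z)%:R * g x y z (s x) (s y) (s z)) =
   \sum_x \sum_y \sum_z (apart s x y z)%:R *
   (B x y * (A y z * A x z + A y z * A (s x) z)) +
   \sum_x \sum_y \sum_z (apart s x y z)%:R * g x y z (s x) (s y) (s z).
  do 2 (rewrite -big_split; apply: eq_bigr => ? _ /=).
  by rewrite -big_split.
rewrite lerD2r.
apply: le_trans (_ : \sum_x \sum_y B x y * 2 <= _); last first.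
  under eq_bigr do rewrite -mulr_suml.
  by rewrite -mulr_suml mulrC ler_wpM2l //; apply: sum_sum_step.
apply: ler_sum => x _; apply: ler_sum => y _.
(* The codegree bounds require [y] to differ from [x] and [s x]; otherwise the summand vanishes. *)
have [->|yx] := eqVneq y x.
  by rewrite /step edge_irr mul0r !mul0r big1 // => z _; rewrite mul0r mulr0.
have [->|ysx] := eqVneq y (s x).
  rewrite big1; first by apply: mulr_ge0 => //; apply: step_ge0.
  move=> z _.
  by rewrite /apart /= !inE eqxx /= andbF mul0r.
apply: le_trans (_ : \sum_z (B x y * (A y z * A x z + A y z * A (s x) z)) <= _).
  apply: ler_sum => z _; apply: ler_piMl; last by case: apart.
  by repeat first [exact: edge_ge0|exact: step_ge0|apply: addr_ge0|apply: mulr_ge0].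
rewrite -mulr_sumr ler_wpM2l ?step_ge0 // big_split /=.
by have := codeg_le1 yx; have := codeg_le1 ysx; lra.
Qed.

End RandomPairing.

(** * Cuts separating the pairs of a fixed pairing *)

Section FixedPairing.
Variables (R : rcfType) (V : finType) (a : rel V).
Hypotheses (a_sym : symmetric a) (a_irr : irreflexive a).
Local Notation A := (edge R a).
Local Notation dg := (deg R a).
Local Notation pdeg := (pair_deg R a).
Local Notation n := (#|V|%:R : R).
Hypothesis codeg_le1 : forall x y, x != y -> \sum_z A x z * A y z <= 1.
Hypothesis deg_ge2 : forall x y, a x y -> 2 <= dg x.
Variable s : {perm V}.
Hypotheses (sK : forall x, s (s x) = x) (s_free : forall x, s x != x).
Implicit Types (x y z : V).

Definition rep x := (enum_rank x < enum_rank (s x))%N.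

Lemma repN x : rep (s x) = ~~ rep x.
Proof.
rewrite /rep sK -leqNgt ltn_neqAle.
by rewrite (inj_eq (inj_comp val_inj enum_rank_inj)) s_free.
Qed.

Lemma sum_s (F : V -> R) : \sum_x F (s x) = \sum_x F x.
Proof. by rewrite [RHS](reindex_inj (@perm_inj _ s)). Qed.

Lemma sum_rep (F : V -> R) : \sum_x F x = \sum_(x | rep x) (F x + F (s x)).
Proof.
rewrite (bigID rep) big_split /=; congr (_ + _).
rewrite [LHS](reindex_inj (@perm_inj _ s)) /=.
by apply: eq_bigl => x; rewrite repN negbK.
Qed.

(** Coefficient of the product of the signs of [x] and [z] when partners carry opposite signs. *)
Definition pair_weight x z : R := A x z + A (s x) (s z) - A x (s z) - A (s x) z.
(* A form in one sign per pair is encoded as a form on [V] supported on the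
   representatives of the pairs. *)
Definition rep_weight x z : R :=
  if [&& rep x, rep z & x != z] then pair_weight x z else 0.
Definition pair_edges x z : R := A x z + A (s x) (s z) + A x (s z) + A (s x) z.

Lemma pair_weight_sym x z : pair_weight x z = pair_weight z x.
Proof.
rewrite /pair_weight (edge_sym _ a_sym x) (edge_sym _ a_sym (s x)).
by rewrite (edge_sym _ a_sym x (s z)) (edge_sym _ a_sym (s x) z); ring.
Qed.
Lemma pair_edges_sym x z : pair_edges x z = pair_edges z x.
Proof.
rewrite /pair_edges (edge_sym _ a_sym x) (edge_sym _ a_sym (s x)).
by rewrite (edge_sym _ a_sym x (s z)) (edge_sym _ a_sym (s x) z); ring.
Qed.
Lemma rep_weight_sym x z : rep_weight x z = rep_weight z x.
Proof. by rewrite /rep_weight pair_weight_sym eq_sym andbCA. Qed.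
Lemma rep_weight_diag x : rep_weight x x = 0.
Proof. by rewrite /rep_weight eqxx !andbF. Qed.
Lemma pair_weight_s x z : pair_weight x (s z) = - pair_weight x z.
Proof. by rewrite /pair_weight sK; ring. Qed.
Lemma pair_weight_sl x z : pair_weight (s x) z = - pair_weight x z.
Proof. by rewrite /pair_weight sK; ring. Qed.
Lemma pair_weight_diag x : pair_weight x x = - (2 * A x (s x)).
Proof. by rewrite /pair_weight !(edge_irr _ a_irr) (edge_sym _ a_sym (s x)); ring. Qed.
Lemma pair_edges_ge0 x z : 0 <= pair_edges x z.
Proof. by rewrite /pair_edges !addr_ge0 ?edge_ge0. Qed.
Lemma normr_rep_weight x z : `|rep_weight x z| <= pair_edges x z.
Proof.
rewrite /rep_weight; case: ifP => _; last by rewrite normr0 pair_edges_ge0.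
have := edge_ge0 R a x z; have := edge_ge0 R a (s x) (s z).
have := edge_ge0 R a x (s z); have := edge_ge0 R a (s x) z.
by rewrite /pair_weight /pair_edges ler_norml => *; apply/andP; split; lra.
Qed.

Definition pair_sign (e : V -> R) x : R := if rep x then e x else - e (s x).

Lemma pair_signN e x : pair_sign e (s x) = - pair_sign e x.
Proof. by rewrite /pair_sign repN sK; case: rep => //=; rewrite opprK. Qed.

Lemma pair_sign_pm (e : V -> R) : (forall x, e x = 1 \/ e x = -1) ->
  forall x, pair_sign e x = 1 \/ pair_sign e x = -1.
Proof.
move=> he x; rewrite /pair_sign; case: rep; first exact: he.
by case: (he (s x)) => ->; [right|left; rewrite opprK].
Qed.

(** Grouped by pairs, the diagonal coefficients [- (2 * A x (s x))] multiply squares equal to 1: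
    edges inside pairs lower the sum whatever the signs. *)
Lemma sum_pair_sign (e : V -> R) : (forall x, e x = 1 \/ e x = -1) ->
  \sum_x \sum_y A x y * pair_sign e x * pair_sign e y =
  \sum_x \sum_y rep_weight x y * e x * e y - \sum_x A x (s x).
Proof.
move=> he.
have -> : \sum_x \sum_y A x y * pair_sign e x * pair_sign e y =
    \sum_(x | rep x) \sum_(y | rep y) pair_weight x y * e x * e y.
  rewrite sum_rep; apply: eq_bigr => x rx.
  rewrite (sum_rep (fun y => A x y * _ * _)) (sum_rep (fun y => A (s x) y * _ * _)).
  rewrite -big_split; apply: eq_bigr => y ry /=.
  by rewrite !pair_signN /pair_sign rx ry /pair_weight; ring.
rewrite (sum_rep (fun x => A x (s x))) [X in _ = X - _](bigID rep) /= [X in _ + X - _]big1.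
  rewrite addr0 -sumrB; apply: eq_bigr => x rx.
  rewrite [X in _ = X - _](bigID rep) /= [X in _ + X - _]big1.
    rewrite addr0 (bigD1 x) //= [X in _ = X - _](bigD1 x) //= rep_weight_diag pair_weight_diag.
    rewrite sK (edge_sym _ a_sym (s x) x) !mul0r add0r.
    have -> : - (2 * A x (s x)) * e x * e x = - (A x (s x) + A x (s x)).
      by case: (he x) => ->; ring.
    rewrite addrC; congr (_ - _); apply: eq_bigr => y /andP[ry yx].
    by rewrite /rep_weight rx ry eq_sym yx.
  by move=> y /negbTE ry; rewrite /rep_weight ry andbF !mul0r.
by move=> x /negbTE rx; rewrite big1 // => y _; rewrite /rep_weight rx !mul0r.
Qed.

(** * Squared weights at a pair *)

Lemma pair_deg_ge0 x : 0 <= pdeg s x.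
Proof. by rewrite /pair_deg mulr_ge0 // addr_ge0 // deg_ge0. Qed.

Lemma pair_deg_s x : pdeg s (s x) = pdeg s x.
Proof. by rewrite /pair_deg sK addrC. Qed.

Let u x z : R := A x z - A (s x) z.

Lemma pair_weight_u x z : pair_weight x z = u x z - u x (s z).
Proof. by rewrite /pair_weight /u; ring. Qed.

Lemma sum_u x : \sum_z u x z ^+ 2 = dg x + dg (s x) - 2 * \sum_z A x z * A (s x) z.
Proof.
rewrite mulr_sumr -sumrN -!big_split; apply: eq_bigr => z _ /=.
by rewrite /u sqrrB !edge_sqr; ring.
Qed.

Lemma sum_rep_weight_sqr_le q : \sum_p rep_weight q p ^+ 2 <= pdeg s q.
Proof.
apply: le_trans (_ : \sum_p (2 * u q p ^+ 2 + 2 * u q (s p) ^+ 2) <= _).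
  apply: ler_sum => p _; rewrite /rep_weight; case: ifP => _.
    rewrite pair_weight_u -subr_ge0; set c := u q p; set d := u q (s p).
    have -> : 2 * c ^+ 2 + 2 * d ^+ 2 - (c - d) ^+ 2 = (c + d) ^+ 2 by ring.
    exact: sqr_ge0.
  by rewrite expr0n addr_ge0 // mulr_ge0 // sqr_ge0.
rewrite big_split /= -!mulr_sumr (sum_s (fun p => u q p ^+ 2)) sum_u /pair_deg.
have : 0 <= \sum_z A q z * A (s q) z by apply: sumr_ge0 => z _; rewrite mulr_ge0 ?edge_ge0.
lra.
Qed.

(* Twice the number of pairs inside the neighbourhood of [x]. *)
Definition nbr_pairs x : R := \sum_z A x z * A x (s z).

(** Sum of squared weights at the pair of [x], taken over all vertices: halving corrects for meeting
    each pair twice, and [4 * A x (s x)] is the square of the diagonal weight. *)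
Definition row x : R := (\sum_p pair_weight x p ^+ 2) / 2 - 4 * A x (s x).

Lemma row_s x : row (s x) = row x.
Proof.
rewrite /row sK (edge_sym _ a_sym (s x)); congr (_ / _ - _).
by apply: eq_bigr => p _; rewrite pair_weight_sl sqrrN.
Qed.

Lemma sum_rep_weight_sqr q : rep q -> \sum_p rep_weight q p ^+ 2 = row q.
Proof.
move=> rq; rewrite /row (sum_rep (fun p => pair_weight q p ^+ 2)).
have -> : \sum_(p | rep p) (pair_weight q p ^+ 2 + pair_weight q (s p) ^+ 2) =
    2 * \sum_(p | rep p) pair_weight q p ^+ 2.
  by rewrite mulr_sumr; apply: eq_bigr => p _; rewrite pair_weight_s sqrrN; ring.
rewrite (bigID rep) /= [X in _ + X]big1 ?addr0; last first.
  by move=> p /negbTE rp; rewrite /rep_weight rp andbF expr0n.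
rewrite (bigD1 q) //= [in RHS](bigD1 q) //= rep_weight_diag pair_weight_diag expr0n add0r.
rewrite sqrrN exprMn edge_sqr.
rewrite (eq_bigr (fun p => pair_weight q p ^+ 2)); last first.
  by move=> p /andP[rp pq]; rewrite /rep_weight rp rq eq_sym pq.
by set X := \sum_(_ | _) _; field.
Qed.

(** Edges are lost at a common neighbour of [x] and [s x], at a pair inside one neighbourhood, or
    inside the pair itself. The first loss costs at most half of the degrees; the others are
    subtracted explicitly. *)
Lemma row_ge x : (dg x + dg (s x)) / 2 - nbr_pairs x - nbr_pairs (s x) - 4 * A x (s x)
   <= row x.
Proof.
rewrite /row lerD2r.
have -> : \sum_p pair_weight x p ^+ 2 = 2 * (\sum_z u x z ^+ 2) - 2 * \sum_z u x z * u x (s z).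
  have -> : 2 * (\sum_z u x z ^+ 2) = \sum_z u x z ^+ 2 + \sum_z u x (s z) ^+ 2.
    by rewrite (sum_s (fun z => u x z ^+ 2)); ring.
  rewrite mulr_sumr -sumrN -!big_split; apply: eq_bigr => z _ /=.
  by rewrite pair_weight_u; ring.
have h1 : \sum_z u x z * u x (s z) <= nbr_pairs x + nbr_pairs (s x).
  rewrite -big_split; apply: ler_sum => z _ /=; rewrite /u -subr_ge0.
  have -> : A x z * A x (s z) + A (s x) z * A (s x) (s z) -
    (A x z - A (s x) z) * (A x (s z) - A (s x) (s z)) =
    A x z * A (s x) (s z) + A (s x) z * A x (s z) by ring.
  by rewrite addr_ge0 // mulr_ge0 // edge_ge0.
(* There is at most one common neighbour, and its presence forces both degrees to be at least 2. *)
have h2 : 4 * \sum_z A x z * A (s x) z <= dg x + dg (s x).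
  have := deg_ge0 R a x; have := deg_ge0 R a (s x) => d1 d2.
  have [/existsP[z /andP[xz sxz]]|no] := boolP [exists z, a x z && a (s x) z].
    have := codeg_le1 (s_free x); have := deg_ge2 xz; have := deg_ge2 sxz.
    have -> : \sum_z A (s x) z * A x z = \sum_z A x z * A (s x) z.
      by apply: eq_bigr => ? _; rewrite mulrC.
    lra.
  rewrite big1 ?mulr0 ?addr_ge0 // => z _.
  move: no; rewrite negb_exists => /forallP/(_ z); rewrite /edge.
  by case: (a x z) => //=; rewrite ?mul0r // => /negbTE ->; rewrite mulr0.
by rewrite sum_u; lra.
Qed.

Lemma sqrt_pdeg x : Num.sqrt (pdeg s x) = 2 * Num.sqrt (dg x + dg (s x)).
Proof.
by rewrite /pair_deg sqrtrM // (_ : 4 = 2 ^+ 2) ?sqrtr_sqr ?ger0_norm //; ring.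
Qed.

Lemma div_sqrt (t : R) : 0 <= t -> t / Num.sqrt t = Num.sqrt t.
Proof.
move=> t0; have [->|h] := eqVneq t 0; first by rewrite sqrtr0 mul0r.
by rewrite -{1}(sqr_sqrtr t0) expr2 mulfK // sqrtr_eq0 -ltNge lt_neqAle eq_sym h.
Qed.

(** The side condition covers degree 0, where the right-hand side is 0 by the convention on
    inverses. *)
Lemma div_sqrt_pdeg x (c : R) : 0 <= c -> (dg x = 0 -> c = 0) ->
  c / Num.sqrt (dg x + dg (s x)) <= c / Num.sqrt (dg x).
Proof.
move=> c0 hc; have := deg_ge0 R a x; have := deg_ge0 R a (s x) => d1 d2.
have [/hc ->|h] := eqVneq (dg x) 0; first by rewrite !mul0r.
have dp : 0 < dg x by rewrite lt_neqAle eq_sym h.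
rewrite ler_wpM2l // lef_pV2 ?posrE ?sqrtr_gt0 ?ler_sqrt //; lra.
Qed.

Lemma edge_deg0 x y : dg x = 0 -> A x y = 0.
Proof.
move=> d0; apply/eqP; rewrite eq_le edge_ge0 andbT -d0 /deg (bigD1 y) //= lerDl.
by apply: sumr_ge0 => z _; apply: edge_ge0.
Qed.

(** The factor 1/8 is a product of three halves: the cancellation in [row_ge], the square root of
    the 4 in [pair_deg], and one representative per two vertices. *)
Lemma gain_ge :
  (\sum_x Num.sqrt (dg x)) / 8 -
  (\sum_x (2 * nbr_pairs x + 4 * A x (s x)) / Num.sqrt (dg x)) / 4 <=
  \sum_q (\sum_p rep_weight q p ^+ 2) / Num.sqrt (pdeg s q).
Proof.
have -> : \sum_q (\sum_p rep_weight q p ^+ 2) / Num.sqrt (pdeg s q) =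
    (\sum_q row q / Num.sqrt (pdeg s q)) / 2.
  rewrite (sum_rep (fun q => row q / _)) (bigID rep) /= [X in _ + X]big1 ?addr0.
    rewrite mulr_suml; apply: eq_bigr => q rq.
    by rewrite sum_rep_weight_sqr // row_s pair_deg_s; set i := (Num.sqrt _)^-1; field.
  by move=> q /negbTE rq; rewrite big1 ?mul0r // => p _; rewrite /rep_weight rq expr0n.
pose d2 x := Num.sqrt (dg x + dg (s x)).
have nb0 x : 0 <= nbr_pairs x.
  by apply: sumr_ge0 => z _; rewrite mulr_ge0 ?edge_ge0.
have h : \sum_q (d2 q / 4 - (nbr_pairs q / d2 q + nbr_pairs (s q) / d2 q +
    4 * A q (s q) / d2 q) / 2) <= \sum_q row q / Num.sqrt (pdeg s q).
  apply: ler_sum => q _; rewrite sqrt_pdeg -/(d2 q) invfM mulrA.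
  have i0 : 0 <= (d2 q)^-1 by rewrite invr_ge0 sqrtr_ge0.
  have := ler_wpM2r i0 (row_ge q).
  have := div_sqrt (addr_ge0 (deg_ge0 R a q) (deg_ge0 R a (s q))); rewrite -/(d2 q).
  set i := (d2 q)^-1; set D := dg q + _; lra.
have e1 : \sum_q nbr_pairs (s q) / d2 q = \sum_q nbr_pairs q / d2 q.
  rewrite -[RHS]sum_s; apply: eq_bigr => q _.
  by rewrite /d2 sK [dg (s q) + _]addrC.
have e2 : \sum_x Num.sqrt (dg x) <= \sum_x d2 x.
  apply: ler_sum => x _; apply: ler_wsqrtr; have := deg_ge0 R a (s x); lra.
have e3 : \sum_x (2 * nbr_pairs x + 4 * A x (s x)) / d2 x <=
   \sum_x (2 * nbr_pairs x + 4 * A x (s x)) / Num.sqrt (dg x).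
  apply: ler_sum => x _; apply: div_sqrt_pdeg.
    by rewrite addr_ge0 // mulr_ge0 // edge_ge0.
  move=> d0; rewrite edge_deg0 // /nbr_pairs big1 ?mulr0 ?addr0 // => z _.
  by rewrite edge_deg0 // mul0r.
have e4 : \sum_q (d2 q / 4 - (nbr_pairs q / d2 q + nbr_pairs (s q) / d2 q +
    4 * A q (s q) / d2 q) / 2) = (\sum_q d2 q) / 4 -
   (\sum_x (2 * nbr_pairs x + 4 * A x (s x)) / d2 x) / 2.
  rewrite !big_split /= sumrN -!mulr_suml !big_split /= e1.
  under [X in _ = _ - X / 2]eq_bigr do rewrite mulrDl -mulrA.
  by rewrite big_split /= -mulr_sumr; ring.
lra.
Qed.

(** * Triangles of the multigraph of pairs *)

Lemma apart_sx x y z : apart s (s x) y z = apart s x y z.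
Proof. by rewrite /apart sK; apply/perm_uniq; rewrite (perm_catCA [:: s x] [:: x]). Qed.

Lemma apart_swap x y z : apart s y x z = apart s x y z.
Proof. by apply/perm_uniq; rewrite (perm_catCA [:: y; s y] [:: x; s x]). Qed.

Lemma apart_rot x y z : apart s x y z = apart s y z x.
Proof. by apply/perm_uniq; rewrite (perm_catC [:: x; s x] [:: y; s y; z; s z]). Qed.

Lemma apart_sy x y z : apart s x (s y) z = apart s x y z.
Proof. by rewrite apart_rot apart_sx -apart_rot. Qed.

Lemma apart_sz x y z : apart s x y (s z) = apart s x y z.
Proof. by rewrite apart_rot apart_sy -apart_rot. Qed.

Lemma sum8 (H : V -> V -> V -> R) :
  \sum_x \sum_y \sum_z (H x y z + H (s x) y z + H x (s y) z + H (s x) (s y) z +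
     (H x y (s z) + H (s x) y (s z) + H x (s y) (s z) + H (s x) (s y) (s z))) =
  8 * \sum_x \sum_y \sum_z H x y z.
Proof.
have e3 x y : \sum_z (H x y z + H (s x) y z + H x (s y) z + H (s x) (s y) z +
     (H x y (s z) + H (s x) y (s z) + H x (s y) (s z) + H (s x) (s y) (s z))) =
   2 * (\sum_z H x y z + \sum_z H (s x) y z + (\sum_z H x (s y) z + \sum_z H (s x) (s y) z)).
  rewrite big_split /=.
  rewrite (sum_s (fun z => H x y z + H (s x) y z + H x (s y) z + H (s x) (s y) z)).
  by rewrite !big_split /=; ring.
under eq_bigr do under eq_bigr do rewrite e3.
have e2 x : \sum_y 2 * (\sum_z H x y z + \sum_z H (s x) y z +
    (\sum_z H x (s y) z + \sum_z H (s x) (s y) z)) =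
   4 * (\sum_y \sum_z H x y z + \sum_y \sum_z H (s x) y z).
  rewrite -mulr_sumr big_split /= (sum_s (fun y => \sum_z H x y z + \sum_z H (s x) y z)).
  by rewrite !big_split /=; ring.
under eq_bigr do rewrite e2.
by rewrite -mulr_sumr big_split /= (sum_s (fun x => \sum_y \sum_z H x y z)); ring.
Qed.

(** The eight exchanges of partners turn [half_triangles] into all 64 products of edges between
    three pairs. The inequality of means splits the product of square roots in the denominator. *)
Lemma triangles_le :
  \sum_q \sum_r \sum_p `|rep_weight q r| * `|rep_weight q p| * `|rep_weight r p| /
     (Num.sqrt (pdeg s q) * Num.sqrt (pdeg s r)) <=
  8 * \sum_x \sum_y \sum_z (apart s x y z)%:R * (half_triangles R a s x y z / pdeg s x).
Proof.
pose Phi x y z : R :=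
  (apart s x y z)%:R * (pair_edges x y * pair_edges y z * pair_edges z x) / pdeg s x.
have -> : 8 * \sum_x \sum_y \sum_z
    (apart s x y z)%:R * (half_triangles R a s x y z / pdeg s x) =
    \sum_x \sum_y \sum_z Phi x y z.
  rewrite -sum8; apply: eq_bigr => x _; apply: eq_bigr => y _; apply: eq_bigr => z _.
  rewrite !apart_sx !apart_sy !apart_sz !pair_deg_s /Phi /half_triangles /pair_edges !sK.
  set i := (pdeg s x)^-1; ring.
have sw : \sum_q \sum_r \sum_p Phi q r p = \sum_q \sum_r \sum_p Phi r q p.
  by rewrite exchange_big.
suff h : \sum_q \sum_r \sum_p `|rep_weight q r| * `|rep_weight q p| * `|rep_weight r p| /
     (Num.sqrt (pdeg s q) * Num.sqrt (pdeg s r)) <=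
    \sum_q \sum_r \sum_p (Phi q r p / 2 + Phi r q p / 2).
  apply: le_trans h _.
  have -> : \sum_q \sum_r \sum_p (Phi q r p / 2 + Phi r q p / 2) =
     \sum_q \sum_r \sum_p Phi q r p / 2 + \sum_q \sum_r \sum_p Phi r q p / 2.
    by do 2 (rewrite -big_split; apply: eq_bigr => ? _ /=); rewrite -big_split.
  have half (F : V -> V -> V -> R) : \sum_q \sum_r \sum_p F q r p / 2 =
      (\sum_q \sum_r \sum_p F q r p) / 2.
    by do 2 (rewrite mulr_suml; apply: eq_bigr => ? _); rewrite mulr_suml.
  by rewrite half (half (fun q r p => Phi r q p)) -sw; lra.
apply: ler_sum => q _; apply: ler_sum => r _; apply: ler_sum => p _.
have Phi0 x y z : 0 <= Phi x y z.
  by rewrite /Phi divr_ge0 ?pair_deg_ge0 // mulr_ge0 ?ler0n // !mulr_ge0 ?pair_edges_ge0.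
(* Distinct representatives lie in distinct pairs, so other triples meet a vanishing weight. *)
have [ap|nap] := boolP (apart s q r p); last first.
  suff -> : `|rep_weight q r| * `|rep_weight q p| * `|rep_weight r p| = 0.
    by rewrite mul0r; apply: addr_ge0; apply: divr_ge0.
  rewrite /rep_weight; case: (boolP (rep q)) => rq; last by rewrite normr0 !mul0r.
  case: (boolP (rep r)) => rr; last by rewrite normr0 !mul0r.
  case: (boolP (rep p)) => rp; last by rewrite normr0 !mulr0.
  have [|qr] := eqVneq q r; first by rewrite normr0 !mul0r.
  have [|qp] := eqVneq q p; first by rewrite normr0 mulr0 !mul0r.
  have [|rp'] := eqVneq r p; first by rewrite normr0 !mulr0.
  have ns x y : rep x -> rep y -> (x == s y) = false.
    by move=> rx ry; apply/eqP => e; move: rx; rewrite e repN ry.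
  case/negP: nap; rewrite /apart /= !inE !negb_or.
  have ns' x y : rep x -> rep y -> (s x == y) = false by move=> *; rewrite eq_sym ns.
  by rewrite !(inj_eq perm_inj) !ns // !ns' // qr qp rp'.
have key (b c : R) : 0 <= b -> 0 <= c ->
   (Num.sqrt b * Num.sqrt c)^-1 <= b^-1 / 2 + c^-1 / 2.
  move=> b0 c0; rewrite invfM.
  have -> : b^-1 = (Num.sqrt b)^-1 ^+ 2 by rewrite exprVn sqr_sqrtr.
  have -> : c^-1 = (Num.sqrt c)^-1 ^+ 2 by rewrite exprVn sqr_sqrtr.
  have := sqr_ge0 ((Num.sqrt b)^-1 - (Num.sqrt c)^-1); lra.
apply: le_trans (_ : pair_edges q r * pair_edges q p * pair_edges r p *
   ((pdeg s q)^-1 / 2 + (pdeg s r)^-1 / 2) <= _).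
  apply: ler_pM => //; rewrite ?invr_ge0 ?mulr_ge0 ?sqrtr_ge0 ?key ?pair_deg_ge0 //.
  by do 2 (apply: ler_pM; rewrite ?mulr_ge0 ?normr_rep_weight //).
rewrite /Phi (apart_swap q r p) ap !mul1r.
rewrite (pair_edges_sym p q) (pair_edges_sym p r) (pair_edges_sym r q).
by rewrite le_eqVlt; apply/orP; left; apply/eqP; ring.
Qed.

End FixedPairing.

(** * Choice of the pairing *)

Section BestPairing.
Variables (R : rcfType) (V : finType) (a : rel V).
Hypotheses (a_sym : symmetric a) (a_irr : irreflexive a).
Local Notation A := (edge R a).
Local Notation dg := (deg R a).
Local Notation n := (#|V|%:R : R).
Local Notation M := (pairings V).
Hypothesis codeg_le1 : forall x y, x != y -> \sum_z A x z * A y z <= 1.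
Hypothesis deg_ge2 : forall x y, a x y -> 2 <= dg x.
Hypothesis V_even : ~~ odd #|V|.
Local Notation S0 := (\sum_x Num.sqrt (dg x)).

Lemma sum_pairings_eq x y : (10 <= #|V|)%N ->
  \sum_(s in M) (s x == y)%:R <= 2 * #|M|%:R / n.
Proof.
move=> V10; have [<-|xy] := eqVneq x y.
  rewrite big1; first by rewrite divr_ge0 ?mulr_ge0 ?ler0n.
  by move=> s /pairingsP[_ /(_ x)/negbTE ->].
have := @sum_pairings_matches R V [:: (x, y)]; rewrite /endpoints /= inE xy !expr1.
have -> : \sum_(s in M) (matches [:: (x, y)] s)%:R = \sum_(s in M) (s x == y)%:R :> R.
  by apply: eq_bigr => s _; rewrite /matches /= andbT.
apply=> //; first exact: leq_trans V10.
by rewrite (@leq_trans (10 + 2)) // leq_add2r.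
Qed.

Lemma deg_cases x : dg x = 0 \/ 2 <= dg x.
Proof.
have [/existsP[y /deg_ge2]|no] := boolP [exists y, a x y]; first by right.
left; apply: big1 => y _; move: no; rewrite negb_exists => /forallP/(_ y)/negbTE.
by rewrite /edge => ->.
Qed.

(** Any given pair occurs with probability at most [2 / n], so [nbr_pairs] has mean at most
    [2 * d ^ 2 / n] and the inner edge [2 * d / n], where [d <= d ^ 2]; this gives the constant
    [2 * 2 + 4 * 2]. *)
Lemma avg_loss : (10 <= #|V|)%N ->
  \sum_(s in M) \sum_x (2 * nbr_pairs R a s x + 4 * A x (s x)) / Num.sqrt (dg x) <=
  12 * #|M|%:R / n * \sum_x dg x * Num.sqrt (dg x).
Proof.
move=> V10; pose c := 2 * #|M|%:R / n.
have c0 : 0 <= c by rewrite divr_ge0 ?mulr_ge0 ?ler0n.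
have h1 x : \sum_(s in M) A x (s x) <= c * dg x.
  under eq_bigr do rewrite -(sum_delta (A x)).
  rewrite exchange_big /= /deg mulr_sumr; apply: ler_sum => y _.
  by rewrite -mulr_suml ler_wpM2r ?edge_ge0 ?sum_pairings_eq.
have h2 x : \sum_(s in M) nbr_pairs R a s x <= c * dg x ^+ 2.
  rewrite /nbr_pairs exchange_big /= expr2 {1}/deg mulr_suml mulr_sumr.
  apply: ler_sum => z _; rewrite -mulr_sumr mulrCA ler_wpM2l ?edge_ge0 //.
  under eq_bigr do rewrite -(sum_delta (A x)).
  rewrite exchange_big /= /deg mulr_sumr; apply: ler_sum => y _.
  by rewrite -mulr_suml ler_wpM2r ?edge_ge0 ?sum_pairings_eq.
rewrite exchange_big mulr_sumr /=; apply: ler_sum => x _.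
rewrite -mulr_suml big_split /= -!mulr_sumr.
apply: le_trans (_ : 6 * c * dg x ^+ 2 / Num.sqrt (dg x) <= _).
  rewrite ler_wpM2r ?invr_ge0 ?sqrtr_ge0 //.
  have := h1 x; have := h2 x.
  have : c * dg x <= c * dg x ^+ 2.
    by rewrite ler_wpM2l //; case: (deg_cases x) => [->|h]; nra.
  lra.
rewrite -mulrA expr2 -[dg x * _ / _]mulrA div_sqrt ?deg_ge0 // /c.
by rewrite le_eqVlt; apply/orP; left; apply/eqP; ring.
Qed.

(** Splitting at [Num.sqrt d = c] controls a sum of powers 3/2 of degrees by the sum of their
    squares with a small factor. *)
Lemma pow3_sqrt_le (c d : R) : 0 < c -> 0 <= d -> d * Num.sqrt d <= d ^+ 2 / c + c ^+ 3.
Proof.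
move=> c0 d0; rewrite -{1 3}(sqr_sqrtr d0); set r := Num.sqrt d.
have r0 : 0 <= r by exact: sqrtr_ge0.
have r3 : 0 <= r ^+ 3 by rewrite exprn_ge0.
have c3 : 0 <= c ^+ 3 by rewrite exprn_ge0 // ltW.
have -> : r ^+ 2 * r = r ^+ 3 by ring.
have -> : (r ^+ 2) ^+ 2 = r ^+ 3 * r by ring.
have [rc|cr] := leP r c.
  apply: le_trans (_ : c ^+ 3 <= _); first by rewrite lerXn2r ?nnegrE // ltW.
  by rewrite lerDr divr_ge0 ?mulr_ge0 // ltW.
apply: le_trans (_ : r ^+ 3 * r / c <= _); last by rewrite lerDl.
by rewrite ler_pdivlMr // ler_wpM2l // ltW.
Qed.

(* With [c = 384], the expected cancellation [24 n / c + 12 c ^ 3] is at most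
   [n / 8] beyond the threshold; [bias] makes the second-order loss at most half
   of the gain. *)
Definition threshold : R := 192 * 384 ^+ 3.
Definition bias : R := (128 * 1568)^-1.
Local Notation K := threshold.
Local Notation tau := bias.

Lemma signs_large : 10 <= n -> K <= n -> n <= 2 * S0 ->
  exists2 s, s \in M & exists2 t : V -> R, (forall x, t x = 1 \/ t x = -1) /\
    (forall x, t (s x) = - t x) &
    \sum_x \sum_y A x y * t x * t y <= - (tau / 256 * S0).
Proof.
rewrite (ler_nat _ 10) => V10 Kn nS.
have n0 : 0 < n by rewrite ltr0n (leq_trans _ V10).
have tau0 : 0 <= tau by rewrite invr_ge0 mulr_ge0.
have tau6 : 6 * tau ^+ 2 <= 1 by rewrite /bias; lra.
pose gain s : R := \sum_q (\sum_p rep_weight R a s q p ^+ 2) / Num.sqrt (pair_deg R a s q).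
pose loss s : R := \sum_q \sum_r \sum_p `|rep_weight R a s q r| * `|rep_weight R a s q p| *
  `|rep_weight R a s r p| / (Num.sqrt (pair_deg R a s q) * Num.sqrt (pair_deg R a s r)).
have M0 : 0 < #|M|%:R :> R.
  by have [s hs] := pairings_exists V_even; rewrite ltr0n; apply/card_gt0P; exists s.
have hgain : #|M|%:R * (S0 / 16) <= \sum_(s in M) gain s.
  have h : \sum_(s in M) (S0 / 8 - (\sum_x (2 * nbr_pairs R a s x + 4 * A x (s x)) /
      Num.sqrt (dg x)) / 4) <= \sum_(s in M) gain s.
    by apply: ler_sum => s /pairingsP[sK sF]; apply: gain_ge.
  apply: le_trans h; rewrite sumrB sumr_const -mulr_suml -mulr_natl.
  have hl := avg_loss V10.
  have hd : \sum_x dg x * Num.sqrt (dg x) <= n * (2 * n / 384 + 384 ^+ 3).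
    apply: le_trans (_ : \sum_x (dg x ^+ 2 / 384 + 384 ^+ 3) <= _).
      by apply: ler_sum => x _; apply: pow3_sqrt_le => //; apply: deg_ge0.
    rewrite big_split /= -mulr_suml sum_const.
    by have := sum_deg_sqr a_sym codeg_le1; lra.
  (* A quarter of this bound is half of the main term [S0 / 8], so [S0 / 16] survives. *)
  have : 12 * #|M|%:R / n * \sum_x dg x * Num.sqrt (dg x) <= #|M|%:R * (S0 / 4).
    apply: le_trans (_ : 12 * #|M|%:R / n * (n * (2 * n / 384 + 384 ^+ 3)) <= _).
      by rewrite ler_wpM2l // divr_ge0 ?mulr_ge0 ?ler0n.
    have -> : 12 * #|M|%:R / n * (n * (2 * n / 384 + 384 ^+ 3)) =
       #|M|%:R * (12 * (2 * n / 384 + 384 ^+ 3)).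
      by field; rewrite lt0r_neq0.
    rewrite ler_wpM2l ?ler0n //; move: Kn; rewrite /threshold; lra.
  lra.
(* 1568 is [8 * 98 * 2], with 8 from [triangles_le], 98 from [avg_half_triangles] and 2 from
   [n <= 2 * S0]. *)
have hloss : \sum_(s in M) loss s <= #|M|%:R * (1568 * S0).
  have h : \sum_(s in M) loss s <= \sum_(s in M) 8 * \sum_x \sum_y \sum_z
     (apart s x y z)%:R * (half_triangles R a s x y z / pair_deg R a s x).
    by apply: ler_sum => s /pairingsP[sK sF]; apply: triangles_le.
  apply: le_trans h _; rewrite -mulr_sumr.
  have := avg_half_triangles a_sym a_irr codeg_le1 deg_ge2 V10.
  have : #|M|%:R * n <= #|M|%:R * (2 * S0) by rewrite ler_wpM2l ?ler0n.
  lra.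
(* The mean of the right-hand side is at least [(tau / 64 - tau / 128) * S0], so some pairing
   reaches half of that. *)
have [s hs hgl] : exists2 s, s \in M & tau / 256 * S0 <= tau / 4 * gain s - tau ^+ 2 * loss s.
  have [/existsP[s /andP[? ?]]|no] := boolP [exists s in M,
    tau / 256 * S0 <= tau / 4 * gain s - tau ^+ 2 * loss s]; first by exists s.
  have : \sum_(s in M) (tau / 4 * gain s - tau ^+ 2 * loss s) <=
      \sum_(s in M) tau / 256 * S0.
    apply: ler_sum => s hs; move: no; rewrite negb_exists => /forallP/(_ s).
    by rewrite hs /= -ltNge => /ltW.
  rewrite sumrB -!mulr_sumr sumr_const -mulr_natl => hh.
  have tp : 0 < tau by rewrite invr_gt0 mulr_gt0.
  have : tau / 4 * (#|M|%:R * (S0 / 16)) <= tau / 4 * \sum_(s in M) gain s.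
    by rewrite ler_wpM2l // divr_ge0.
  have : tau ^+ 2 * \sum_(s in M) loss s <= tau ^+ 2 * (#|M|%:R * (1568 * S0)).
    by rewrite ler_wpM2l // sqr_ge0.
  have -> : tau ^+ 2 * (#|M|%:R * (1568 * S0)) = tau / 128 * (#|M|%:R * S0).
    by rewrite /bias; field.
  have : 0 < tau * (#|M|%:R * S0).
    by rewrite mulr_gt0 // mulr_gt0 //; move: n0 nS; lra.
  move: hh; lra.
have /pairingsP[sK sF] := hs.
have [e he hle] := quadratic_form_signs (rep_weight_sym R a_sym s) (rep_weight_diag R a s)
  (sum_rep_weight_sqr_le R a s) tau0 tau6.
exists s => //; exists (pair_sign s e); first split.
- exact: pair_sign_pm.
- by move=> x; rewrite pair_signN.
rewrite sum_pair_sign //; have : 0 <= \sum_x A x (s x) by apply: sumr_ge0 => x _; apply: edge_ge0.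
move: hle hgl; rewrite -/(gain s) -/(loss s); lra.
Qed.

(** With multiplier 0 the form is at most 0, and the edge put inside a pair lowers the sum by at
    least 1. *)
Lemma signs_small x y : a x y ->
  exists2 s, s \in M & exists2 t : V -> R, (forall x, t x = 1 \/ t x = -1) /\
    (forall x, t (s x) = - t x) &
    \sum_x \sum_y A x y * t x * t y <= - 1.
Proof.
move=> axy; have xy : x != y by apply: contraTneq axy => ->; rewrite a_irr.
have [s hs sxy] := pairings_edge xy V_even.
have /pairingsP[sK sF] := hs.
have t0 : 6 * 0 ^+ 2 <= 1 :> R by lra.
have [e he hle] := quadratic_form_signs (rep_weight_sym R a_sym s) (rep_weight_diag R a s)
  (sum_rep_weight_sqr_le R a s) (lexx 0) t0.
exists s => //; exists (pair_sign s e); first split.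
- exact: pair_sign_pm.
- by move=> z; rewrite pair_signN.
rewrite sum_pair_sign //.
have : 1 <= \sum_x A x (s x).
  rewrite (bigD1 x) //= sxy /edge axy lerDl.
  by apply: sumr_ge0 => z _; apply: edge_ge0.
by move: hle; rewrite expr0n !mul0r subr0; lra.
Qed.

End BestPairing.

(** * From signs to bisections *)

Lemma balanced_signs (R : rcfType) : exists2 c : R, 0 < c &
  forall (V : finType) (a : rel V), symmetric a -> irreflexive a ->
    (forall x y z z', x != y -> a x z -> a y z -> a x z' -> a y z' -> z = z') ->
    (forall x y, a x y -> 2 <= deg R a x) ->
    (exists x y, a x y) -> ~~ odd #|V| ->
    #|V|%:R <= 2 * \sum_x Num.sqrt (deg R a x) ->
    exists2 t : V -> R, (forall x, t x = 1 \/ t x = -1) /\ \sum_x t x = 0 &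
      \sum_x \sum_y edge R a x y * t x * t y <= - (c * \sum_x Num.sqrt (deg R a x)).
Proof.
have K1 : 1 <= threshold R ^+ 2 by rewrite exprn_ege1 // /threshold; lra.
have b0 : 0 < bias R by rewrite invr_gt0 mulr_gt0.
have b1 : bias R <= 1 by rewrite /bias; lra.
(* Below the threshold [S <= n ^+ 2 <= threshold ^+ 2], so after this division a gain of 1
   suffices. *)
exists (bias R / 256 / threshold R ^+ 2); first by rewrite !divr_gt0 //; lra.
move=> V a a_sym a_irr C4 deg2 [x0 [y0 a0]] ev nS.
set S := \sum_x _ in nS *; set n := #|V|%:R in nS.
have n0 : 0 <= n by exact: ler0n.
have S0 : 0 <= S by apply: sumr_ge0 => x _; apply: sqrtr_ge0.
have cod x y : x != y -> \sum_z edge R a x z * edge R a y z <= 1.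
  move=> xy; have [/existsP[z /andP[xz yz]]|no] := boolP [exists z, a x z && a y z].
    rewrite (bigD1 z) //= big1 ?addr0; first by rewrite /edge xz yz mulr1.
    move=> z' zz'; rewrite /edge; case: (boolP (a x z')) => xz'; last by rewrite mul0r.
    case: (boolP (a y z')) => yz'; last by rewrite mulr0.
    by rewrite (C4 x y z z') // eqxx in zz'.
  rewrite big1 ?ler01 // => z _; move: no; rewrite negb_exists => /forallP/(_ z).
  by rewrite /edge; case: (a x z) => //=; rewrite ?mul0r // => /negbTE ->; rewrite mulr0.
suff [s hs [t [t1 ts] ht]] : exists2 s, s \in pairings V &
    exists2 t : V -> R, (forall x, t x = 1 \/ t x = -1) /\ (forall x, t (s x) = - t x) &
    \sum_x \sum_y edge R a x y * t x * t y <= - (bias R / 256 / threshold R ^+ 2 * S).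
  exists t => //; split=> //.
  have : \sum_x t x = - \sum_x t x.
    by rewrite -sumrN [LHS](reindex_inj (@perm_inj _ s)); apply: eq_bigr => x _; rewrite ts.
  lra.
have [Kn|nK] := leP (threshold R) n.
  have n10 : 10 <= n by apply: le_trans Kn; rewrite /threshold; lra.
  have [s hs [t ht hle]] := signs_large a_sym a_irr cod deg2 ev n10 Kn nS.
  exists s => //; exists t => //; apply: le_trans hle _; rewrite lerN2 -/S mulrAC.
  rewrite ler_pdivrMr; last by lra.
  by rewrite ler_peMr // mulr_ge0 // divr_ge0 // ltW.
have [s hs [t ht hle]] := signs_small R a_sym a_irr ev a0.
exists s => //; exists t => //; apply: le_trans hle _; rewrite lerN2 mulrAC.
rewrite ler_pdivrMr ?mul1r; last by lra.
have hS : S <= n * n.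
  rewrite /S /n -sum_const; apply: ler_sum => x _; apply: le_trans (deg_le R a x).
  have [->|h] := deg_cases deg2 x; first by rewrite sqrtr0.
  rewrite -[leRHS]ger0_norm ?deg_ge0 // -sqrtr_sqr ler_wsqrtr //; nra.
have : n * n <= threshold R ^+ 2 by rewrite -expr2 lerXn2r ?nnegrE // ltW // (le_lt_trans n0).
have : bias R / 256 * S <= S by rewrite ler_piMl //; lra.
lra.
Qed.

Section Cut.
Variables (R : rcfType) (G : sgraph).
Local Notation adj := (@adj G).
Local Notation A := (edge R adj).

Lemma degree_deg (x : G) : (degree x)%:R = deg R adj x.
Proof.
rewrite /degree -sum1_card natr_sum big_mkcond /=; apply: eq_bigr => y _.
by rewrite inE /edge; case: adj.
Qed.

Lemma card_edges_le : #|edges G|%:R * 2 <= \sum_x \sum_y A x y.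
Proof.
have -> : \sum_x \sum_y A x y = #|[set p : G * G | adj p.1 p.2]|%:R.
  rewrite pair_big -sum1_card natr_sum [RHS]big_mkcond /=; apply: eq_bigr => p _.
  by rewrite inE /edge; case: adj.
rewrite -natrM ler_nat.
rewrite -[X in (_ <= X)%N]sum1_card.
rewrite (partition_big (fun p : G * G => [set p.1; p.2]) (mem (edges G))) /=; last first.
  by move=> [x y]; rewrite inE /= => xy; apply/imset2P; exists x y; rewrite ?inE.
rewrite -sum_nat_const; apply: leq_sum => E /imset2P[x y _]; rewrite inE => /= xy ->.
have nxy : x != y by apply: contraTneq xy => ->; rewrite adj_irrefl.
rewrite sum1dep_card; apply: leq_trans (_ : #|[set (x, y); (y, x)]| <= _)%N.
  by rewrite cards2 xpair_eqE negb_and nxy.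
apply: subset_leq_card; apply/subsetP => p; rewrite !inE.
case/orP=> /eqP -> /=; first by rewrite xy eqxx.
by rewrite adj_sym xy setUC eqxx.
Qed.

(** Disjointness reveals which endpoint of an edge lies in [V0], so ordered pairs from [V0] to [V1]
    inject into edges. *)
Lemma bisection_size_ge (V0 V1 : {set G}) : [disjoint V0 & V1] ->
  \sum_(x in V0) \sum_(y in V1) A x y <= (bisection_size V0 V1)%:R.
Proof.
move=> dis.
have -> : \sum_(x in V0) \sum_(y in V1) A x y =
    #|[set p : G * G | [&& p.1 \in V0, p.2 \in V1 & adj p.1 p.2]]|%:R.
  rewrite pair_big -sum1_card natr_sum big_mkcond [RHS]big_mkcond /=.
  apply: eq_bigr => p _; rewrite inE /edge.
  by case: (p.1 \in V0); case: (p.2 \in V1); case: adj.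
rewrite ler_nat -(card_in_imset (f := fun p : G * G => [set p.1; p.2])).
  apply: subset_leq_card; apply/subsetP => E /imsetP[[x y]]; rewrite inE /=.
  case/and3P=> x0 y1 xy ->; rewrite inE; apply/andP; split.
    by apply/imset2P; exists x y; rewrite ?inE.
  by apply/existsP; exists x; rewrite x0; apply/existsP; exists y; rewrite y1 eqxx.
move=> [x y] [x' y']; rewrite !inE /= => /and3P[x0 y1 _] /and3P[x0' y1' _] E.
have ne u v : u \in V0 -> v \in V1 -> (u == v) = false.
  by move=> u0 v1; apply/eqP => uv; move/disjointFr: dis => /(_ u u0); rewrite uv v1.
have : x \in [set x'; y'] by rewrite -E !inE eqxx.
have : y \in [set x'; y'] by rewrite -E !inE eqxx orbT.
rewrite !inE (ne x y') // orbF => h /eqP ->; move: h.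
by rewrite eq_sym (ne x' y) //= => /eqP ->.
Qed.

(** The two sides have indicators [(1 + t x) / 2] and [(1 - t x) / 2]; in the expanded product the
    linear terms cancel by symmetry of adjacency. *)
Lemma bisection_of_signs (t : G -> R) (c : R) :
  (forall x, t x = 1 \/ t x = -1) -> `|\sum_x t x| <= 1 ->
  \sum_x \sum_y A x y * t x * t y <= - c ->
  exists V0 V1 : {set G}, is_bisection V0 V1 /\
    #|edges G|%:R / 2 + c / 4 <= (bisection_size V0 V1)%:R.
Proof.
move=> t1 tb tc; pose V0 := [set x | t x == 1]; exists V0, (~: V0).
have N1 : (-1 == 1 :> R) = false by apply/eqP; lra.
have dis : [disjoint V0 & ~: V0] by rewrite -setI_eq0 setICr.
have eV0 x : (x \in V0)%:R = (1 + t x) / 2 :> R.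
  by rewrite inE; case: (t1 x) => ->; rewrite ?eqxx ?N1 /=; field.
have eV1 x : (x \in ~: V0)%:R = (1 - t x) / 2 :> R.
  by rewrite !inE; case: (t1 x) => ->; rewrite ?eqxx ?N1 /=; field.
split.
  split; [exact: setUCr | exact: dis |].
  suff e : (#|V0|%:Z - #|~: V0|%:Z)%:~R = \sum_x t x :> R.
    by rewrite -(ler_int R) intr_norm e.
  rewrite rmorphB /= -!pmulrn -!sum1_card !natr_sum [X in X - _]big_mkcond.
  rewrite [X in _ - X]big_mkcond -sumrB; apply: eq_bigr => x _ /=.
  have := eV0 x; have := eV1 x; do 2 case: (x \in _) => /=; lra.
apply: le_trans (bisection_size_ge dis).
have -> : \sum_(x in V0) \sum_(y in ~: V0) A x y =
   \sum_x \sum_y A x y * ((1 + t x) / 2) * ((1 - t y) / 2).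
  rewrite big_mkcond; apply: eq_bigr => x _; rewrite -eV0.
  case: (x \in V0) => /=; last by rewrite big1 // => y _; rewrite mulr0 mul0r.
  rewrite big_mkcond; apply: eq_bigr => y _; rewrite -eV1 mulr1.
  by case: (y \in _); rewrite ?mulr1 ?mulr0.
have sw : \sum_x \sum_y A x y * t x = \sum_x \sum_y A x y * t y.
  rewrite exchange_big; apply: eq_bigr => x _; apply: eq_bigr => y _.
  by rewrite (edge_sym _ (@adj_sym G)).
have -> : \sum_x \sum_y A x y * ((1 + t x) / 2) * ((1 - t y) / 2) =
  (\sum_x \sum_y A x y + \sum_x \sum_y A x y * t x - \sum_x \sum_y A x y * t y -
   \sum_x \sum_y A x y * t x * t y) / 4.
  rewrite -big_split -!sumrB mulr_suml; apply: eq_bigr => x _ /=.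
  by rewrite -big_split -!sumrB mulr_suml; apply: eq_bigr => y _ /=; field.
have := card_edges_le; lra.
Qed.

End Cut.

(** * Reduction to an even number of vertices *)

Lemma sum_option (R : nmodType) (T : finType) (F : option T -> R) :
  \sum_x F x = F None + \sum_x F (Some x).
Proof.
rewrite (bigD1 None) //=; congr (_ + _).
rewrite (reindex_omap (Some : T -> option T) id) //=; last by case.
by apply: eq_bigl => x; rewrite eqxx.
Qed.

Definition opt_rel (T : finType) (r : rel T) : rel (option T) :=
  fun x y => if (x, y) is (Some x, Some y) then r x y else false.

Theorem theorem1p3 (R : realType) :
  exists2 xi : R, 0 < xi &
    forall G : sgraph,
      connected_graph G ->
      ~ has_cycle G 4 ->
      ~ has_cycle G 6 ->
      (forall d : nat, d \in degree_sequence G -> (2 <= d)%N) ->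
      exists V0 V1 : {set G},
        is_bisection V0 V1 /\
        #|edges G|%:R / 2 + xi * \sum_(d <- degree_sequence G) Num.sqrt d%:R
          <= (bisection_size V0 V1)%:R.
Proof.
have [c c0 hc] := balanced_signs R; exists (c / 4); first by rewrite divr_gt0.
move=> G [G0 _] noC4 _ hdeg.
have -> : \sum_(d <- degree_sequence G) Num.sqrt d%:R = \sum_x Num.sqrt (deg R (@adj G) x).
  rewrite (perm_big [seq degree x | x : G]) ?perm_sort //= big_map big_enum /=.
  by apply: eq_bigr => x _; rewrite degree_deg.
set S := \sum_x _.
have deg2 x : 2 <= deg R (@adj G) x.
  rewrite -degree_deg (ler_nat _ 2); apply: hdeg.
  by rewrite mem_sort; apply/mapP; exists x; rewrite ?mem_enum.
(* Two common neighbours [z], [z'] of [x] and [y] close the cycle [x, z, y, z']. *)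
have C4 (x y z z' : G) : x != y -> adj x z -> adj y z -> adj x z' -> adj y z' -> z = z'.
  move=> xy xz yz xz' yz'; apply/eqP; apply/negPn/negP => zz'; apply: noC4.
  have ne (u v : G) : adj u v -> (u == v) = false.
    by move=> uv; apply/eqP => e; move: uv; rewrite e adj_irrefl.
  exists [:: x; z; y; z'] => //; apply/andP; split.
    by rewrite /= xz (adj_sym z y) yz yz' (adj_sym z' x) xz'.
  by rewrite /= !inE !negb_or (ne x z) // xy (ne x z') // (eq_sym z y) (ne y z) // zz' (ne y z').
have [x0 _] : exists x0 : G, x0 \in G by apply/card_gt0P.
have [y0 a0] : exists y, adj x0 y.
  have /hdeg : degree x0 \in degree_sequence G.
    by rewrite mem_sort; apply/mapP; exists x0; rewrite ?mem_enum.
  by move=> /ltnW/card_gt0P[y]; rewrite inE; exists y.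
have hS : #|G|%:R <= S.
  rewrite -[leLHS]mulr1 -(@sum_const R G 1); apply: ler_sum => x _.
  by rewrite -[leLHS]sqrtr1 ler_wsqrtr //; have := deg2 x; lra.
suff [t [t1 tb] ht] : exists2 t : G -> R, (forall x, t x = 1 \/ t x = -1) /\
    `|\sum_x t x| <= 1 & \sum_x \sum_y edge R (@adj G) x y * t x * t y <= - (c * S).
  have [V0 [V1 [bis le]]] := bisection_of_signs t1 tb ht.
  by exists V0, V1; split=> //; apply: le_trans le; rewrite lerD2l; lra.
have [od|ev] := boolP (odd #|G|); last first.
  have [||t [t1 t0] ht] := hc G (@adj G) (@adj_sym G) (@adj_irrefl G) C4 (fun x _ _ => deg2 x) _ ev.
  - by exists x0, y0.
  - by rewrite -/S; have := ler0n R #|G|; lra.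
  by exists t => //; rewrite t0 normr0.
pose a := opt_rel (@adj G).
have dgS x : deg R a (Some x) = deg R (@adj G) x by rewrite /deg sum_option add0r.
have dg0 : deg R a None = 0 by rewrite /deg big1.
have SE : \sum_x Num.sqrt (deg R a x) = S.
  by rewrite sum_option dg0 sqrtr0 add0r; apply: eq_bigr => x _; rewrite dgS.
have [|||||||t [t1 t0] ht] := hc _ a.
- by case=> [x|] [y|] //; apply: adj_sym.
- by case=> [x|] //; apply: adj_irrefl.
- move=> [x|] [y|] [z|] [z'|] //= xy xz yz xz' yz'; congr Some.
  exact: C4 xz yz xz' yz'.
- by move=> [x|] // y _; rewrite dgS.
- by exists (Some x0), (Some y0).
- by rewrite card_option /= od.
(* The factor 2 in the hypothesis pays for the isolated vertex: [n + 1 <= 2 * n <= 2 * S]. *)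
- rewrite SE card_option -natr1; have : 1 <= #|G|%:R :> R by rewrite ler1n.
  lra.
exists (fun x => t (Some x)); last first.
  rewrite -SE; apply: le_trans ht; rewrite [leRHS]sum_option [X in _ <= X + _]big1 ?add0r.
    rewrite le_eqVlt; apply/orP; left; apply/eqP; apply: eq_bigr => x _.
    by rewrite sum_option /edge /a /= !mul0r add0r.
  by move=> y _; rewrite /edge /a /= !mul0r.
(* Deleting the extra vertex leaves the total [- t None], of absolute value 1. *)
split=> //; move: t0; rewrite sum_option => t0.
have -> : \sum_x t (Some x) = - t None by lra.
by case: (t1 None) => ->; rewrite ?opprK ?normrN normr1.
Qed.
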